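(* $\mathsf{RCA}_0$ proves: every complete separable metric space which is Heine-Borel compact is Atsuji.
   Context: Systems. $\mathsf{RCA}_0$ is the theory in the two-sorted language of second order arithmetic (number variables, set variables, $0,1,+,\cdot,=,<,\in$) consisting of the basic arithmetical axioms, induction for $\Sigma^0_1$ formulas and comprehension for $\Delta^0_1$ formulas. Spaces (definitions made in $\mathsf{RCA}_0$; reals are coded by rapidly converging Cauchy sequences of rationals). A (code for a) complete separable metric space $\widehat A$ is a set $A\subseteq\mathbb N$ together with $d:A\times A\to\mathbb R$ such that $d(a,a)=0$, $d(a,b)=d(b,a)\ge 0$, $d(a,b)\le d(a,c)+d(c,b)$ for all $a,b,c\in A$. A point of $\widehat A$ is a sequence $\langle a_n:n\in\mathbb N\rangle$ of elements of $A$ with $d(a_n,a_{n+1})<2^{-n}$ for all $n$; $d$ extends to points in the obvious way (also written $d_{\widehat A}$) and $x,y\in\widehat A$ are identified ($x=y$) when $d(x,y)=0$. $B(x,q)$ denotes the open ball $\{y\in\widehat A: d(x,y)<q\}$. An open set in $\widehat A$ is coded by a sequence $\langle (a_n,q_n):n\in\mathbb N\rangle$ of elements of $A\times\mathbb Q^+$ and means $\bigcup_n B(a_n,q_n)$. An open covering of $\widehat A$ is a sequence $\langle U_n:n\in\mathbb N\rangle$ of open sets such that every $x\in\widehat A$ belongs to some $U_n$. Heine-Borel compact: $\widehat A$ is Heine-Borel compact if every open covering of $\widehat A$ has a finite subcovering. Continuous functions: a (code for a) continuous function from $\widehat A$ to $\widehat B$ is a set $\Phi\subseteq\mathbb N\times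 A\times\mathbb Q^+\times B\times\mathbb Q^+$ such that, writing $(a,r)\Phi(b,s)$ for $\exists n\,(n,a,r,b,s)\in\Phi$: (i) $(a,r)\Phi(b,s)\wedge(a,r)\Phi(b',s')\to d(b,b')<s+s'$; (ii) $(a,r)\Phi(b,s)\wedge d(b,b')+s\le s'\to(a,r)\Phi(b',s')$; (iii) $(a,r)\Phi(b,s)\wedge d(a,a')+r'\le r\to(a',r')\Phi(b,s)$; (iv) $\forall x\in\widehat A\,\forall q\in\mathbb Q^+\,\exists(a,r,b,s)\,((a,r)\Phi(b,s)\wedge d(x,a)<r\wedge s<q)$. For $x\in\widehat A$, $f(x)$ is the unique $y\in\widehat B$ with $d(y,b)<s$ whenever $d(x,a)<r$ and $(a,r)\Phi(b,s)$. The function $f$ is uniformly continuous if $\forall\varepsilon\in\mathbb R^+\,\exists\delta\in\mathbb R^+\,\forall x,y\in\widehat A\,(d_{\widehat A}(x,y)<\delta\to d_{\widehat B}(f(x),f(y))<\varepsilon)$. Atsuji: $\widehat A$ is Atsuji if every continuous function $f:\widehat A\to\widehat B$, with $\widehat B$ an arbitrary complete separable metric space, is uniformly continuous. *)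

(* Defs.v *)
From Stdlib Require Import List.
Import ListNotations.

(** Second order arithmetic, with de Bruijn indices, counted separately for number and for set variables.
    Set terms are variables, and [=] relates numbers only. *)

Inductive term : Type :=
| Var (n : nat)
| Zero
| One
| Plus (s t : term)
| Times (s t : term).

Inductive form : Type :=
| Equ (s t : term)
| Less (s t : term)
| Mem (t : term) (X : nat)
| Bot
| Imp (p q : form)
| AllNum (p : form)
| AllSet (p : form).

(** The logic is classical, so the other connectives are abbreviations. *)
Definition Not (p : form) : form := Imp p Bot.
Definition And (p q : form) : form := Not (Imp p (Not q)).
Definition Or (p q : form) : form := Imp (Not p) q.
Definition Iff (p q : form) : form := And (Imp p q) (Imp q p).
Definition ExNum (p : form) : form := Not (AllNum (Not p)).
Definition ExSet (p : form) : form := Not (AllSet (Not p)).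

Fixpoint tsubst (f : nat -> term) (t : term) : term :=
  match t with
  | Var n => f n
  | Zero => Zero
  | One => One
  | Plus s u => Plus (tsubst f s) (tsubst f u)
  | Times s u => Times (tsubst f s) (tsubst f u)
  end.

Definition tshift : term -> term := tsubst (fun n => Var (S n)).

Definition scons {T : Type} (x : T) (f : nat -> T) (n : nat) : T :=
  match n with 0 => x | S k => f k end.

(** Simultaneous substitution of terms for the number variables and renaming
    of the set variables. *)
Fixpoint subst (f : nat -> term) (g : nat -> nat) (p : form) : form :=
  match p with
  | Equ s t => Equ (tsubst f s) (tsubst f t)
  | Less s t => Less (tsubst f s) (tsubst f t)
  | Mem t X => Mem (tsubst f t) (g X)
  | Bot => Bot
  | Imp p q => Imp (subst f g p) (subst f g q)
  | AllNum p => AllNum (subst (scons (Var 0) (fun n => tshift (f n))) g p)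
  | AllSet p => AllSet (subst f (scons 0 (fun n => S (g n))) p)
  end.

Definition idS (n : nat) : nat := n.
Definition shiftN (p : form) : form := subst (fun n => Var (S n)) idS p.
Definition shiftS (p : form) : form := subst Var S p.
Definition instN (t : term) (p : form) : form := subst (scons t Var) idS p.
Definition instS (X : nat) (p : form) : form := subst Var (scons X idS) p.

(** Classical natural deduction.  Eigenvariable conditions concern the hypotheses only: an axiom with free
    variables may be generalised, that is, it stands for its universal
    closure. *)

Inductive prv (T : form -> Prop) : list form -> form -> Prop :=
| prv_ax G p : T p -> prv T G p
| prv_hyp G p : In p G -> prv T G p
| prv_impI G p q : prv T (p :: G) q -> prv T G (Imp p q)
| prv_impE G p q : prv T G (Imp p q) -> prv T G p -> prv T G q
| prv_raa G p : prv T (Not p :: G) Bot -> prv T G p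
| prv_allNI G p : prv T (map shiftN G) p -> prv T G (AllNum p)
| prv_allNE G p t : prv T G (AllNum p) -> prv T G (instN t p)
| prv_allSI G p : prv T (map shiftS G) p -> prv T G (AllSet p)
| prv_allSE G p X : prv T G (AllSet p) -> prv T G (instS X p)
| prv_eq_refl G t : prv T G (Equ t t)
| prv_eq_subst G p s t :
    prv T G (Equ s t) -> prv T G (instN s p) -> prv T G (instN t p).

Definition provable (T : form -> Prop) (p : form) : Prop := prv T nil p.

(** Bounded existential quantification is [Not (AllNum (Imp (Less ..) (Not ..)))]. *)
Inductive Delta0 : form -> Prop :=
| Delta0_eq s t : Delta0 (Equ s t)
| Delta0_lt s t : Delta0 (Less s t)
| Delta0_mem t X : Delta0 (Mem t X)
| Delta0_bot : Delta0 Bot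
| Delta0_imp p q : Delta0 p -> Delta0 q -> Delta0 (Imp p q)
| Delta0_ball t p :
    Delta0 p -> Delta0 (AllNum (Imp (Less (Var 0) (tshift t)) p)).

Inductive Sigma1 : form -> Prop :=
| Sigma1_intro p : Delta0 p -> Sigma1 (ExNum p).

Inductive Pi1 : form -> Prop :=
| Pi1_intro p : Delta0 p -> Pi1 (AllNum p).

(** The distinguished variable of [p] is number variable 0; all the others are
    parameters. *)
Definition induction_for (p : form) : form :=
  Imp (And (instN Zero p)
           (AllNum (Imp p (subst (scons (Plus (Var 0) One)
                                      (fun n => Var (S n))) idS p))))
      (AllNum p).

(** The set asserted to exist does not occur in [p], by the shift. *)
Definition comprehension_for (p q : form) : form :=
  Imp (AllNum (Iff p q))
      (ExSet (AllNum (Iff (Mem (Var 0) 0) (shiftS p)))).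

Inductive RCA0 : form -> Prop :=
| PA_succ_neq0 : RCA0 (Not (Equ (Plus (Var 0) One) Zero))
| PA_succ_inj :
    RCA0 (Imp (Equ (Plus (Var 0) One) (Plus (Var 1) One)) (Equ (Var 0) (Var 1)))
| PA_add0 : RCA0 (Equ (Plus (Var 0) Zero) (Var 0))
| PA_addS :
    RCA0 (Equ (Plus (Var 0) (Plus (Var 1) One)) (Plus (Plus (Var 0) (Var 1)) One))
| PA_mul0 : RCA0 (Equ (Times (Var 0) Zero) Zero)
| PA_mulS :
    RCA0 (Equ (Times (Var 0) (Plus (Var 1) One))
             (Plus (Times (Var 0) (Var 1)) (Var 0)))
| PA_lt0 : RCA0 (Not (Less (Var 0) Zero))
| PA_ltS :
    RCA0 (Iff (Less (Var 0) (Plus (Var 1) One))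
              (Or (Less (Var 0) (Var 1)) (Equ (Var 0) (Var 1))))
| Sigma1_induction p : Sigma1 p -> RCA0 (induction_for p)
| Delta1_comprehension p q :
    Sigma1 p -> Pi1 q -> RCA0 (comprehension_for p q).

(** A [tm], [sv] or [fm] awaits the number of enclosing number (resp. set)
    quantifiers.  A quantifier passes to its body a variable which remembers
    the level [d] at which it was bound and computes its index, [d' - S d], at
    any depth [d'] of use. *)

Definition tm : Type := nat -> term.
Definition sv : Type := nat -> nat.
Definition fm : Type := nat -> nat -> form.

Definition sentence (P : fm) : form := P 0 0.

Definition zero : tm := fun _ => Zero.
Definition one : tm := fun _ => One.
Definition plus (s t : tm) : tm := fun d => Plus (s d) (t d).
Definition times (s t : tm) : tm := fun d => Times (s d) (t d).

Definition feq (s t : tm) : fm := fun d _ => Equ (s d) (t d).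
Definition flt (s t : tm) : fm := fun d _ => Less (s d) (t d).
Definition fmem (t : tm) (X : sv) : fm := fun d e => Mem (t d) (X e).
Definition fimp (P Q : fm) : fm := fun d e => Imp (P d e) (Q d e).
Definition fneg (P : fm) : fm := fun d e => Not (P d e).
Definition fand (P Q : fm) : fm := fun d e => And (P d e) (Q d e).
Definition for_ (P Q : fm) : fm := fun d e => Or (P d e) (Q d e).
Definition allN (P : tm -> fm) : fm :=
  fun d e => AllNum (P (fun d' => Var (d' - S d)) (S d) e).
Definition exN (P : tm -> fm) : fm :=
  fun d e => ExNum (P (fun d' => Var (d' - S d)) (S d) e).
Definition allS (P : sv -> fm) : fm :=
  fun d e => AllSet (P (fun e' => e' - S e) d (S e)).
Definition exS (P : sv -> fm) : fm :=
  fun d e => ExSet (P (fun e' => e' - S e) d (S e)).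

Declare Scope tm_scope.
Declare Scope fm_scope.
Delimit Scope tm_scope with tm.
Delimit Scope fm_scope with fm.
Bind Scope tm_scope with tm.
Bind Scope fm_scope with fm.
Local Open Scope fm_scope.
Local Open Scope tm_scope.

Notation "0" := zero : tm_scope.
Notation "1" := one : tm_scope.
Infix "+" := plus : tm_scope.
Infix "*" := times : tm_scope.
Infix "==" := feq (at level 70) : fm_scope.
Infix "<" := flt : fm_scope.
Infix "∈" := fmem (at level 70) : fm_scope.
Notation "~ P" := (fneg P) : fm_scope.
Infix "/\" := fand : fm_scope.
Infix "\/" := for_ : fm_scope.
Infix "==>" := fimp (at level 86, right associativity) : fm_scope.

(** Plain [∀], [∃] quantify over numbers, [∀S], [∃S] over sets. *)
Notation "'∀' x .. y , P" := (allN (fun x => .. (allN (fun y => P)) ..))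
  (at level 200, x binder, y binder, right associativity) : fm_scope.
Notation "'∃' x .. y , P" := (exN (fun x => .. (exN (fun y => P)) ..))
  (at level 200, x binder, y binder, right associativity) : fm_scope.
Notation "'∀S' X .. Y , P" := (allS (fun X => .. (allS (fun Y => P)) ..))
  (at level 200, X binder, Y binder, right associativity) : fm_scope.
Notation "'∃S' X .. Y , P" := (exS (fun X => .. (exS (fun Y => P)) ..))
  (at level 200, X binder, Y binder, right associativity) : fm_scope.

(** Injective but not surjective. *)
Definition tpair (s t : tm) : tm := (s + t) * (s + t) + s.
Notation "⟨ s , t ⟩" := (tpair s t) : tm_scope.

(** Definable classes of numbers. *)
Definition cls : Type := tm -> fm.
Definition Num : cls := fun x => x == x.
Definition El (A : sv) : cls := fun x => x ∈ A.
Definition Prod (C D : cls) : cls :=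
  fun z => ∃ x y, z == ⟨x, y⟩ /\ C x /\ D y.

Definition is_fun (F : sv) (C D : cls) : fm :=
  (∀ z, z ∈ F ==> Prod C D z)
  /\ (∀ x, C x ==> ∃ y, ⟨x, y⟩ ∈ F)
  /\ (∀ x y y', ⟨x, y⟩ ∈ F /\ ⟨x, y'⟩ ∈ F ==> y == y').

(** [Rat m n p] is the rational [(m - n) / (p + 1)].  A rational has several
    representations; [rat_le] and [rat_lt] compare values. *)
Record rat : Type := Rat { rp : tm; rn : tm; rd : tm }.

Definition code (q : rat) : tm := ⟨⟨rp q, rn q⟩, rd q⟩.

Definition allQ (P : rat -> fm) : fm := ∀ m n p, P (Rat m n p).
Definition exQ (P : rat -> fm) : fm := ∃ m n p, P (Rat m n p).
Notation "'∀Q' q .. r , P" := (allQ (fun q => .. (allQ (fun r => P)) ..))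
  (at level 200, q binder, r binder, right associativity) : fm_scope.
Notation "'∃Q' q .. r , P" := (exQ (fun q => .. (exQ (fun r => P)) ..))
  (at level 200, q binder, r binder, right associativity) : fm_scope.

Definition rat_lt (q r : rat) : fm :=
  rp q * (rd r + 1) + rn r * (rd q + 1) < rp r * (rd q + 1) + rn q * (rd r + 1).
Definition rat_le (q r : rat) : fm := ~ rat_lt r q.
Definition rat_pos (q : rat) : fm := rn q < rp q.

(** The denominator is [rd q * rd r + rd q + rd r + 1]. *)
Definition rat_add (q r : rat) : rat :=
  Rat (rp q * (rd r + 1) + rp r * (rd q + 1))
      (rn q * (rd r + 1) + rn r * (rd q + 1))
      (rd q * rd r + rd q + rd r).

Definition QQ : cls := fun x => ∃Q q, x == code q.
Definition QQpos : cls := fun x => ∃Q q, x == code q /\ rat_pos q.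

(** [e = 2 ^ k]; exponentiation is not in the language and is introduced by
    primitive recursion. *)
Definition is_pow2 (k e : tm) : fm :=
  ∃S F, is_fun F Num Num
        /\ ⟨0, 1⟩ ∈ F
        /\ (∀ i j, ⟨i, j⟩ ∈ F ==> ⟨i + 1, j + j⟩ ∈ F)
        /\ ⟨k, e⟩ ∈ F.

(** [P (2 ^ - k)]. *)
Definition at_pow (k : tm) (P : rat -> fm) : fm :=
  ∃ p, is_pow2 k (p + 1) /\ P (Rat 1 0 p).

(** A real is given by its graph: [x k q] says that [q] is the [k]-th rational
    approximation of [x]. *)
Definition real : Type := tm -> rat -> fm.

Definition real_of_set (X : sv) : real := fun k q => ⟨k, code q⟩ ∈ X.
Definition real_of_rat (r : rat) : real := fun _ q => code q == code r.
Coercion real_of_rat : rat >-> real.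

Definition is_cauchy (x : real) : fm :=
  ∀ k i, ∀Q q q', x k q /\ x (k + i) q' ==>
    at_pow k (fun e => rat_le q (rat_add q' e) /\ rat_le q' (rat_add q e)).

Definition is_real (X : sv) : fm := is_fun X Num QQ /\ is_cauchy (real_of_set X).

(** [x <= y] iff [x_k <= y_k + 2 * 2 ^ - k] for all [k]. *)
Definition real_le (x y : real) : fm :=
  ∀ k, ∀Q q q', x k q /\ y k q' ==>
    at_pow k (fun e => rat_le q (rat_add q' (rat_add e e))).
Definition real_lt (x y : real) : fm := ~ real_le y x.
Definition real_eq (x y : real) : fm := real_le x y /\ real_le y x.

(** The [k]-th approximation of [x + y] is [x_{k+1} + y_{k+1}]. *)
Definition real_add (x y : real) : real := fun k q =>
  ∃Q r s, x (k + 1) r /\ y (k + 1) s /\ code q == code (rat_add r s).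

Definition rat0 : rat := Rat 0 0 0.

(** A space is a set [A] with a set [D] coding a function
    [A x A x N -> Q], i.e. an [A x A]-indexed sequence of reals. *)

Definition dist (D : sv) (a b : tm) : real := fun k q => ⟨⟨⟨a, b⟩, k⟩, code q⟩ ∈ D.

Definition is_space (A D : sv) : fm :=
  is_fun D (Prod (Prod (El A) (El A)) Num) QQ
  /\ (∀ a b, a ∈ A /\ b ∈ A ==> is_cauchy (dist D a b))
  /\ (∀ a, a ∈ A ==> real_eq (dist D a a) rat0)
  /\ (∀ a b, a ∈ A /\ b ∈ A ==>
        real_eq (dist D a b) (dist D b a) /\ real_le rat0 (dist D a b))
  /\ (∀ a b c, a ∈ A /\ b ∈ A /\ c ∈ A ==>
        real_le (dist D a b) (real_add (dist D a c) (dist D c b))).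

Definition is_point (A D X : sv) : fm :=
  is_fun X Num (El A)
  /\ (∀ n a b, ⟨n, a⟩ ∈ X /\ ⟨n + 1, b⟩ ∈ X ==>
        at_pow n (fun e => real_lt (dist D a b) e)).

(** A point given by its graph, so that [a] in [A] is also the point
    [a, a, a, ...]. *)
Definition pt : Type := tm -> tm -> fm.
Definition pt_of_set (X : sv) : pt := fun n a => ⟨n, a⟩ ∈ X.
Definition pt_of_elt (b : tm) : pt := fun _ a => a == b.
Coercion pt_of_set : sv >-> pt.

(** The real [lim_n d (x_n, y_n)].  Its [k]-th approximation is the [k+3]-rd one
    of [d (x_{k+3}, y_{k+3})].  The offset makes this a code of a real: from
    [d (x_n, x_{n+1}) < 2 ^ - n], the approximations for [k] and for any later
    index differ by at most [(1 + 4 + 1/2) * 2 ^ - (k+3) < 2 ^ - k]. *)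
Definition pdist (D : sv) (x y : pt) : real := fun k q =>
  ∃ a b, x (k + (1 + 1 + 1)) a /\ y (k + (1 + 1 + 1)) b
         /\ dist D a b (k + (1 + 1 + 1)) q.

(** A sequence of codes of open sets: the [m]-th ball of [U_n] is [B (a, r)],
    where [U (n, m) = (a, r)]. *)
Definition is_open_seq (A U : sv) : fm :=
  is_fun U (Prod Num Num) (Prod (El A) QQpos).

Definition in_open (D : sv) (X : sv) (U : sv) (n : tm) : fm :=
  ∃ m a, ∃Q r, ⟨⟨n, m⟩, ⟨a, code r⟩⟩ ∈ U /\ real_lt (pdist D (pt_of_elt a) X) r.

Definition is_open_covering (A D U : sv) : fm :=
  is_open_seq A U /\ (∀S X, is_point A D X ==> ∃ n, in_open D X U n).

Definition heine_borel (A D : sv) : fm :=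
  ∀S U, is_open_covering A D U ==>
    ∃ N, ∀S X, is_point A D X ==> ∃ n, n < N /\ in_open D X U n.

(** [(a, r) Phi (b, s)]. *)
Definition rel (Phi : sv) (a : tm) (r : rat) (b : tm) (s : rat) : fm :=
  ∃ n, ⟨n, ⟨a, ⟨code r, ⟨b, code s⟩⟩⟩⟩ ∈ Phi.

Definition is_continuous (A D B E Phi : sv) : fm :=
  (∀ z, z ∈ Phi ==>
     Prod Num (Prod (El A) (Prod QQpos (Prod (El B) QQpos))) z)
  /\ (∀ a b b', ∀Q r s s',
        rel Phi a r b s /\ rel Phi a r b' s' ==>
        real_lt (dist E b b') (rat_add s s'))
  /\ (∀ a b b', ∀Q r s s', b' ∈ B /\ rat_pos s' ==>
        rel Phi a r b s /\ real_le (real_add (dist E b b') s) s' ==>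
        rel Phi a r b' s')
  /\ (∀ a a' b, ∀Q r r' s, a' ∈ A /\ rat_pos r' ==>
        rel Phi a r b s /\ real_le (real_add (dist D a a') r') r ==>
        rel Phi a' r' b s)
  /\ (∀S X, is_point A D X ==> ∀Q q, rat_pos q ==>
        ∃ a b, ∃Q r s, rel Phi a r b s
          /\ real_lt (pdist D X (pt_of_elt a)) r /\ rat_lt s q).

(** [f X = Y], where [f] is coded by [Phi]. *)
Definition is_value (D B E Phi X Y : sv) : fm :=
  is_point B E Y
  /\ (∀ a b, ∀Q r s,
        rel Phi a r b s /\ real_lt (pdist D X (pt_of_elt a)) r ==>
        real_lt (pdist E Y (pt_of_elt b)) s).

Definition is_pos_real (X : sv) : fm :=
  is_real X /\ real_lt rat0 (real_of_set X).

(** [f x] and [f y] are eliminated as definite descriptions: RCA0 proves that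
    the value at a point exists and is unique up to equality of points. *)
Definition is_unif_continuous (A D B E Phi : sv) : fm :=
  ∀S eps, is_pos_real eps ==>
    ∃S del, is_pos_real del /\
      ∀S X Y, is_point A D X /\ is_point A D Y ==>
        real_lt (pdist D X Y) (real_of_set del) ==>
        ∀S V W, is_value D B E Phi X V /\ is_value D B E Phi Y W ==>
          real_lt (pdist E V W) (real_of_set eps).

Definition atsuji (A D : sv) : fm :=
  ∀S B E Phi, is_space B E /\ is_continuous A D B E Phi ==>
    is_unif_continuous A D B E Phi.

(* Main.v *)
(** By the completeness theorem (Henkin) it suffices to prove the statement in
    every model M of RCA0, with the ambient logic available.

    The numbers of M embed in an ordered field K of fractions, in which the
    rationals of M take their values.  Given f and eps, choose a rational
    q = 2^-k / 4 with 2^-k < eps from some index on.  The balls B(a, r - 1/(p+1))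
    for which (a,r) Phi (b,s) with s < q cover the space.  Such a ball is given
    an index that bounds p, so a bound on the indices of a finite subcovering
    bounds the numbers p and gives a Lebesgue number delta: if d(x,y) < delta and
    x is in B(a, r - 1/(p+1)), then x and y are both in B(a, r), whence
    d(f(x), f(y)) < 2 s < eps.  An index that codes no ball is mapped to a fixed
    ball of the covering, since a code of an open set contains at least one ball. *)

Require Defs.
From HB Require Import structures.
From mathcomp Require all_boot all_order all_algebra lra ring boolp.

(** The ambient logic reasons freely about a model, but a set enters the model only by Delta-1
    comprehension, and an induction runs inside it only for Sigma-1 formulas (from which Pi-1
    induction follows); the numbers may be nonstandard. Every such appeal therefore carries a proof
    of definability. This shapes the covering: strict inequality of reals is only Sigma-1, so the
    code of the covering compares rationals alone and never asks whether a point lies in a ball.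
    Shrinking is possible because [d(x, a) < r] leaves a positive gap, and it is recorded because no
    single gap serves all points. Reading the gap off the index avoids forming a minimum over a
    finite family inside the model. The quarter in q leaves 2 s < 2^-k / 2, strictly below the
    eventual lower bound 2^-k of eps. The graph of 2^k has to be built from codes of finite sets
    before any distance can be discussed. *)

Module Semantics.
Import -(notations) Defs.
Import all_boot boolp.

Set Implicit Arguments.
Unset Strict Implicit.
Unset Printing Implicit Defensive.

(** * Completeness *)

Definition up (f : nat -> term) : nat -> term :=
  scons (Var 0) (fun n => tshift (f n)).
Definition upS (g : nat -> nat) : nat -> nat := scons 0 (fun n => S (g n)).

Lemma tsubst_ext f f' t : f =1 f' -> tsubst f t = tsubst f' t.
Proof. by move=> e; elim: t => //= [s -> t ->|s -> t ->]. Qed.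

Lemma tsubst_comp f f' t :
  tsubst f' (tsubst f t) = tsubst (fun n => tsubst f' (f n)) t.
Proof. by elim: t => //= [s -> t ->|s -> t ->]. Qed.

Lemma tsubst_var t : tsubst Var t = t.
Proof. by elim: t => //= [s -> t ->|s -> t ->]. Qed.

Lemma subst_ext f f' g g' p : f =1 f' -> g =1 g' -> subst f g p = subst f' g' p.
Proof. by move=> /funext -> /funext ->. Qed.

Lemma up_comp f f' n :
  tsubst (up f') (up f n) = up (fun n => tsubst f' (f n)) n.
Proof. by case: n => //= n; rewrite /tshift !tsubst_comp; apply: tsubst_ext. Qed.

Lemma subst_comp f f' g g' p :
  subst f' g' (subst f g p)
  = subst (fun n => tsubst f' (f n)) (fun n => g' (g n)) p.
Proof.
elim: p f f' g g' => //=.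
- by move=> s t f f' g g'; rewrite !tsubst_comp.
- by move=> s t f f' g g'; rewrite !tsubst_comp.
- by move=> t X f f' g g'; rewrite !tsubst_comp.
- by move=> p IHp q IHq f f' g g'; rewrite IHp IHq.
- by move=> p IHp f f' g g'; rewrite IHp; congr AllNum; apply: subst_ext => n;
    first exact: up_comp.
- by move=> p IHp f f' g g'; rewrite IHp; congr AllSet; apply: subst_ext => [n //|[]].
Qed.

Lemma subst_var p : subst Var idS p = p.
Proof.
elim: p => //= [s t|s t|t X|p -> q ->|p IHp|p IHp]; rewrite ?tsubst_var //.
- by congr AllNum; rewrite -[RHS]IHp; apply: subst_ext => // -[].
- by congr AllSet; rewrite -[RHS]IHp; apply: subst_ext => // -[].
Qed.

Lemma subst_instN f g t p :
  subst f g (instN t p) = instN (tsubst f t) (subst (up f) g p).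
Proof.
rewrite /instN !subst_comp; apply: subst_ext => // -[|n] //=.
by rewrite /tshift tsubst_comp tsubst_var.
Qed.

Lemma instN_up t f g p : instN t (subst (up f) g p) = subst (scons t f) g p.
Proof.
rewrite /instN !subst_comp; apply: subst_ext => // -[|n] //=.
by rewrite /tshift tsubst_comp tsubst_var.
Qed.

Lemma subst_instS f g X p :
  subst f g (instS X p) = instS (g X) (subst f (upS g) p).
Proof.
by rewrite /instS !subst_comp; apply: subst_ext => [n|[]] //=; rewrite tsubst_var.
Qed.

Lemma instS_up X f g p : instS X (subst f (upS g) p) = subst f (scons X g) p.
Proof.
by rewrite /instS !subst_comp; apply: subst_ext => [n|[]] //=; rewrite tsubst_var.
Qed.

Lemma subst_shiftN f g p : subst (up f) g (shiftN p) = shiftN (subst f g p).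
Proof. by rewrite /shiftN !subst_comp. Qed.

Lemma subst_shiftS f g p : subst f (upS g) (shiftS p) = shiftS (subst f g p).
Proof.
by rewrite /shiftS !subst_comp; apply: subst_ext => // n; rewrite /= tsubst_var.
Qed.

(** * Bounds on the free variables *)

Fixpoint tbound (t : term) : nat :=
  match t with
  | Var n => n.+1
  | Zero | One => 0
  | Plus s u | Times s u => maxn (tbound s) (tbound u)
  end.

Fixpoint boundN (p : form) : nat :=
  match p with
  | Equ s t | Less s t => maxn (tbound s) (tbound t)
  | Defs.Mem t _ => tbound t
  | Bot => 0
  | Imp p q => maxn (boundN p) (boundN q)
  | AllNum p => (boundN p).-1
  | AllSet p => boundN p
  end.

Fixpoint boundS (p : form) : nat :=
  match p with
  | Equ _ _ | Less _ _ | Bot => 0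
  | Defs.Mem _ X => X.+1
  | Imp p q => maxn (boundS p) (boundS q)
  | AllNum p => boundS p
  | AllSet p => (boundS p).-1
  end.

Lemma tsubst_bound f f' t :
  (forall n, n < tbound t -> f n = f' n) -> tsubst f t = tsubst f' t.
Proof.
elim: t => //= [n e|s IHs t IHt e|s IHs t IHt e]; first exact: e.
- by rewrite IHs ?IHt // => n l; apply: e; rewrite leq_max l ?orbT.
- by rewrite IHs ?IHt // => n l; apply: e; rewrite leq_max l ?orbT.
Qed.

Lemma subst_bound f f' g g' p :
  (forall n, n < boundN p -> f n = f' n) -> (forall n, n < boundS p -> g n = g' n) ->
  subst f g p = subst f' g' p.
Proof.
elim: p f f' g g' => //=.
- move=> s t f f' g g' e _; congr Equ; apply: tsubst_bound => n l; apply: e;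
    by rewrite leq_max l ?orbT.
- move=> s t f f' g g' e _; congr Less; apply: tsubst_bound => n l; apply: e;
    by rewrite leq_max l ?orbT.
- by move=> t X f f' g g' e e'; rewrite e' // (tsubst_bound e).
- move=> p IHp q IHq f f' g g' e e'.
  by congr Imp; [apply: IHp|apply: IHq] => n l; [apply: e|apply: e'|apply: e|apply: e'];
    rewrite leq_max l ?orbT.
- move=> p IHp f f' g g' e e'; congr AllNum; apply: IHp => // -[|n] //= l.
  by rewrite e //; case: (boundN p) l.
- move=> p IHp f f' g g' e e'; congr AllSet; apply: IHp => // -[|n] //= l.
  by rewrite e' //; case: (boundS p) l.
Qed.

(** * Substitution in derivations and fresh variables *)

Section Derivations.
Variable T : form -> Prop.

Lemma prv_weaken G G' p :
  prv T G p -> (forall q, List.In q G -> List.In q G') -> prv T G' p.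
Proof.
have ext (f : form -> form) (H H' : list form) :
    (forall q, List.In q H -> List.In q H') ->
    forall q, List.In q (List.map f H) -> List.In q (List.map f H').
  by move=> s q /List.in_map_iff [r [<- /s rH]]; apply/List.in_map.
move=> pf; elim: pf G' => {G p}.
- by move=> *; apply: prv_ax.
- by move=> G p Gp G' s; apply/prv_hyp/s.
- by move=> G p q _ IH G' s; apply/prv_impI/IH => r [->|/s]; [left|right].
- by move=> G p q _ IHi _ IHp G' s; apply: prv_impE (IHi _ s) (IHp _ s).
- by move=> G p _ IH G' s; apply/prv_raa/IH => r [->|/s]; [left|right].
- by move=> G p _ IH G' s; apply: prv_allNI; apply: IH; apply: ext.
- by move=> G p t _ IH G' s; apply: prv_allNE; apply: IH.
- by move=> G p _ IH G' s; apply: prv_allSI; apply: IH; apply: ext.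
- by move=> G p t _ IH G' s; apply: prv_allSE; apply: IH.
- by move=> *; apply: prv_eq_refl.
- by move=> G p u v _ IHe _ IHp G' s; apply: prv_eq_subst (IHe _ s) (IHp _ s).
Qed.

Lemma iter_up k f n :
  iter k up f n = if n < k then Var n else tsubst (fun m => Var (k + m)) (f (n - k)).
Proof.
elim: k n => [|k IH] [|n] //=; rewrite ?subn0 ?tsubst_var // IH ltnS subSS.
by case: ltnP => // _; rewrite /tshift tsubst_comp.
Qed.

Lemma iter_upS k g n : iter k upS g n = if n < k then n else k + g (n - k).
Proof.
by elim: k n => [|k IH] [|n] //=; rewrite IH ltnS subSS; case: ltnP.
Qed.

Lemma subst_iterAllNum k f g p :
  subst f g (iter k AllNum p) = iter k AllNum (subst (iter k up f) g p).
Proof. by elim: k f => //= k IH f; rewrite -/(up f) IH -iterSr. Qed.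

Lemma subst_iterAllSet k f g p :
  subst f g (iter k AllSet p) = iter k AllSet (subst f (iter k upS g) p).
Proof. by elim: k g => //= k IH g; rewrite -/(upS g) IH -iterSr. Qed.

(** The outermost of k + 1 quantifiers binds variable k, so it is instantiated by [f k]. The
    substitution lifts that term past the k remaining quantifiers, and their instantiation undoes
    the lift. *)
Lemma prv_iterAllNum k f G p : prv T G (iter k AllNum p) ->
  prv T G (subst (fun n => if n < k then f n else Var (n - k)) idS p).
Proof.
elim: k p => [|k IH] p /=.
  by rewrite (_ : subst _ _ _ = p) // -[RHS]subst_var; apply: subst_ext => // n;
    rewrite subn0.
move=> /(@prv_allNE _ _ _ (f k)); rewrite /instN subst_iterAllNum => /IH.
rewrite subst_comp; congr prv; apply: subst_ext => // n.
rewrite iter_up; case: (ltngtP n k) => [lt|lt|->] /=.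
- by rewrite lt ltnS ltnW.
- have lt0 : 0 < n - k by rewrite subn_gt0.
  rewrite tsubst_comp [n < k.+1]ltnS [n <= k]leqNgt lt /=.
  rewrite -(prednK lt0) /= ltnNge leq_addr /= addKn; congr Var.
  by rewrite subnS.
- rewrite ltnSn subnn tsubst_comp /= -[RHS]tsubst_var; apply: tsubst_ext => m /=.
  by rewrite ltnNge leq_addr addKn.
Qed.

Lemma prv_iterAllSet k g G p : prv T G (iter k AllSet p) ->
  prv T G (subst Var (fun n => if n < k then g n else n - k) p).
Proof.
elim: k p => [|k IH] p /=.
  by rewrite (_ : subst _ _ _ = p) // -[RHS]subst_var; apply: subst_ext => // n;
    rewrite subn0.
move=> /(@prv_allSE _ _ _ (g k)); rewrite /instS subst_iterAllSet => /IH.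
rewrite subst_comp; congr prv; apply: subst_ext => // n.
rewrite iter_upS; case: (ltngtP n k) => [lt|lt|->] /=.
- by rewrite lt ltnS ltnW.
- have lt0 : 0 < n - k by rewrite subn_gt0.
  rewrite [n < k.+1]ltnS [n <= k]leqNgt lt /= ltnNge leq_addr /= addKn.
  by rewrite -(prednK lt0) subnS.
- by rewrite ltnSn subnn /= ltnNge leq_addr addKn.
Qed.

(** Only quantifier elimination instantiates variables, so the axiom is first closed by enough
    quantifiers of both sorts. This is done in the empty context, where generalisation meets no
    eigenvariable condition; the closure is then weakened to [G] and instantiated. *)
Lemma prv_axiom_subst G p f g : T p -> prv T G (subst f g p).
Proof.
move=> Tp; set k := boundN p; set l := boundS p.
have : prv T G (iter k AllNum (iter l AllSet p)).
  apply: (@prv_weaken [::]) => //.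
  elim: k => [|k IH] /=; last exact: prv_allNI.
  by elim: l => [|l IH] /=; [exact: prv_ax|exact: prv_allSI].
move=> /(prv_iterAllNum f); rewrite subst_iterAllSet => /(prv_iterAllSet g).
rewrite subst_comp; congr prv; apply: subst_bound => n lt.
  by rewrite tsubst_var -/k lt.
by rewrite iter_upS -/l !lt.
Qed.

Lemma prv_subst G p : prv T G p ->
  forall f g, prv T (List.map (subst f g) G) (subst f g p).
Proof.
elim => {G p} /=.
- by move=> G p Tp f g; apply: prv_axiom_subst.
- by move=> G p Gp f g; apply/prv_hyp/List.in_map.
- by move=> G p q _ IH f g; apply/prv_impI/IH.
- by move=> G p q _ IHi _ IHp f g; apply: prv_impE (IHi f g) (IHp f g).
- by move=> G p _ IH f g; apply/prv_raa/IH.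
- move=> G p _ IH f g; apply: prv_allNI; move: (IH (up f) g).
  rewrite !List.map_map; congr prv.
  by apply: List.map_ext => q; rewrite subst_shiftN.
- by move=> G p t _ IH f g; rewrite subst_instN; apply: prv_allNE; apply: IH.
- move=> G p _ IH f g; apply: prv_allSI; move: (IH f (upS g)).
  rewrite !List.map_map; congr prv.
  by apply: List.map_ext => q; rewrite subst_shiftS.
- by move=> G p t _ IH f g; rewrite subst_instS; apply: prv_allSE; apply: IH.
- by move=> *; apply: prv_eq_refl.
- move=> G p u v _ IHe _ IHp f g; rewrite subst_instN.
  by apply: prv_eq_subst (IHe f g) _; rewrite -subst_instN.
Qed.

(** Renaming k to 0 and every other n to n + 1 acts on formulas without k exactly as the shift in
    [prv_allNI], so a derivation for a fresh named variable becomes one for the de Bruijn rule. *)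
Lemma prv_freshN G p k : (forall q, List.In q (AllNum p :: G) -> boundN q <= k) ->
  prv T G (instN (Var k) p) -> prv T G (AllNum p).
Proof.
move=> fresh pf; apply: prv_allNI.
pose f n := if n == k then Var 0 else Var n.+1.
have fS q : boundN q <= k -> subst f idS q = shiftN q.
  by move=> b; apply: subst_bound => // n lt; rewrite /f ltn_eqF // (leq_trans lt).
have := prv_subst pf f idS; rewrite (_ : List.map _ _ = List.map shiftN G); last first.
  by apply: List.map_ext_in => q qG; apply: fS; apply: fresh; right.
rewrite subst_instN instN_up; congr prv; rewrite -[RHS]subst_var.
apply: subst_bound => // -[|n] /=; first by rewrite /f eqxx.
move=> lt; rewrite /f ltn_eqF //.
apply: leq_trans (fresh (AllNum p) _); last by left.
by rewrite /=; case: (boundN p) lt.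
Qed.

Lemma prv_freshS G p k : (forall q, List.In q (AllSet p :: G) -> boundS q <= k) ->
  prv T G (instS k p) -> prv T G (AllSet p).
Proof.
move=> fresh pf; apply: prv_allSI.
pose g n := if n == k then 0 else n.+1.
have gS q : boundS q <= k -> subst Var g q = shiftS q.
  by move=> b; apply: subst_bound => // n lt; rewrite /g ltn_eqF // (leq_trans lt).
have := prv_subst pf Var g; rewrite (_ : List.map _ _ = List.map shiftS G); last first.
  by apply: List.map_ext_in => q qG; apply: gS; apply: fresh; right.
rewrite subst_instS instS_up; congr prv; rewrite -[RHS]subst_var.
apply: subst_bound => // -[|n] /=; first by rewrite /g eqxx.
move=> lt; rewrite /g ltn_eqF //.
apply: leq_trans (fresh (AllSet p) _); last by left.
by rewrite /=; case: (boundS p) lt.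
Qed.

End Derivations.

(** * Structures and satisfaction *)

Record structure := Structure {
  num : Type;
  numset : Type;
  s0 : num;
  s1 : num;
  sadd : num -> num -> num;
  smul : num -> num -> num;
  slt : num -> num -> Prop;
  smem : num -> numset -> Prop }.

Section Satisfaction.
Variable M : structure.

Fixpoint teval (r : nat -> num M) (t : term) : num M :=
  match t with
  | Var n => r n
  | Zero => s0 M
  | One => s1 M
  | Plus s t => sadd (teval r s) (teval r t)
  | Times s t => smul (teval r s) (teval r t)
  end.

Fixpoint sat (r : nat -> num M) (v : nat -> numset M) (p : form) : Prop :=
  match p with
  | Equ s t => teval r s = teval r t
  | Less s t => slt (teval r s) (teval r t)
  | Defs.Mem t X => smem (teval r t) (v X)
  | Bot => False
  | Imp p q => sat r v p -> sat r v q
  | AllNum p => forall x, sat (scons x r) v p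
  | AllSet p => forall X, sat r (scons X v) p
  end.

Lemma teval_subst r f t : teval r (tsubst f t) = teval (fun n => teval r (f n)) t.
Proof. by elim: t => //= s -> t ->. Qed.

Lemma teval_tshift x r t : teval (scons x r) (tshift t) = teval r t.
Proof. exact: teval_subst. Qed.

Lemma sat_subst r v f g p :
  sat r v (subst f g p) <-> sat (fun n => teval r (f n)) (fun n => v (g n)) p.
Proof.
elim: p r v f g => //= [s t|s t|t X|p IHp q IHq|p IHp|p IHp] r v f g;
  rewrite ?teval_subst //.
- by split=> h /IHp /h /IHq.
- split=> h x; [move: (h x) => /IHp|apply/IHp; move: (h x)];
    by congr sat; apply/funext => -[|n] //=; rewrite teval_tshift.
- split=> h X; [move: (h X) => /IHp|apply/IHp; move: (h X)];
    by congr sat; apply/funext => -[|n].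
Qed.

End Satisfaction.

Definition models (M : structure) (T : form -> Prop) : Prop :=
  forall p, T p -> forall r v, sat (M := M) r v p.

(** * Quotients, for the term model and for the field of fractions *)

Section Quotient.
Variables (X : Type) (R : X -> X -> Prop).
Hypotheses (Rxx : forall x, R x x) (Rsym : forall x y, R x y -> R y x).
Hypothesis Rtrans : forall x y z, R x y -> R y z -> R x z.

(** A class is the predicate [R x] itself, so extensionality turns equivalence of representatives
    into equality of classes. *)
Definition quotient := {P : X -> Prop | exists x, P = R x}.
Definition class (x : X) : quotient := exist _ (R x) (ex_intro _ x erefl).
Definition repr (q : quotient) : X := projT1 (cid (proj2_sig q)).

Lemma classK q : class (repr q) = q.
Proof.
case: q => P h; rewrite /repr /=; case: cid => x /= e; apply: eq_exist.
by rewrite -e.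
Qed.

Lemma classE x y : class x = class y <-> R x y.
Proof.
split=> [[e]|xy]; first by rewrite e.
apply: eq_exist; apply/funext => z; apply/propext.
by split; apply: Rtrans => //; apply: Rsym.
Qed.

Lemma reprP x : R (repr (class x)) x.
Proof. by apply/classE; rewrite classK. Qed.

End Quotient.

(** * Countability of the language *)

Fixpoint tterm (t : term) : GenTree.tree nat :=
  match t with
  | Var n => GenTree.Leaf n
  | Zero => GenTree.Node 0 [::]
  | One => GenTree.Node 1 [::]
  | Plus s t => GenTree.Node 2 [:: tterm s; tterm t]
  | Times s t => GenTree.Node 3 [:: tterm s; tterm t]
  end.

Fixpoint termt (t : GenTree.tree nat) : option term :=
  match t with
  | GenTree.Leaf n => Some (Var n)
  | GenTree.Node 0 _ => Some Zero
  | GenTree.Node 1 _ => Some One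
  | GenTree.Node 2 [:: s; t] =>
      obind (fun s => omap (Plus s) (termt t)) (termt s)
  | GenTree.Node _ [:: s; t] =>
      obind (fun s => omap (Times s) (termt t)) (termt s)
  | _ => None
  end.

Lemma ttermK : pcancel tterm termt.
Proof. by elim=> //= s -> t ->. Qed.

HB.instance Definition _ := Countable.copy term (pcan_type ttermK).

Fixpoint tform (p : form) : GenTree.tree (term * nat) :=
  match p with
  | Equ s t => GenTree.Node 0 [:: GenTree.Leaf (s, 0); GenTree.Leaf (t, 0)]
  | Less s t => GenTree.Node 1 [:: GenTree.Leaf (s, 0); GenTree.Leaf (t, 0)]
  | Defs.Mem t X => GenTree.Leaf (t, X)
  | Bot => GenTree.Node 2 [::]
  | Imp p q => GenTree.Node 3 [:: tform p; tform q]
  | AllNum p => GenTree.Node 4 [:: tform p]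
  | AllSet p => GenTree.Node 5 [:: tform p]
  end.

Fixpoint formt (t : GenTree.tree (term * nat)) : option form :=
  match t with
  | GenTree.Leaf (t, X) => Some (Defs.Mem t X)
  | GenTree.Node 0 [:: GenTree.Leaf (s, _); GenTree.Leaf (t, _)] => Some (Equ s t)
  | GenTree.Node 1 [:: GenTree.Leaf (s, _); GenTree.Leaf (t, _)] => Some (Less s t)
  | GenTree.Node 2 _ => Some Bot
  | GenTree.Node 3 [:: p; q] =>
      obind (fun p => omap (Imp p) (formt q)) (formt p)
  | GenTree.Node 4 [:: p] => omap AllNum (formt p)
  | GenTree.Node _ [:: p] => omap AllSet (formt p)
  | _ => None
  end.

Lemma tformK : pcancel tform formt.
Proof. by elim=> //= [p -> q ->|p ->|p ->]. Qed.

HB.instance Definition _ := Countable.copy form (pcan_type tformK).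

(** * Henkin's construction and the term model *)

Section Henkin.
Variables (T : form -> Prop) (G0 : list form).
Hypothesis G0_consistent : ~ prv T G0 Bot.

Definition freshN (G : list form) : nat := foldr (fun q m => maxn (boundN q) m) 0 G.
Definition freshS (G : list form) : nat := foldr (fun q m => maxn (boundS q) m) 0 G.

Lemma freshNP G q : List.In q G -> boundN q <= freshN G.
Proof.
elim: G => //= p G IH [->|/IH l]; first exact: leq_maxl.
by rewrite (leq_trans l) // leq_maxr.
Qed.

Lemma freshSP G q : List.In q G -> boundS q <= freshS G.
Proof.
elim: G => //= p G IH [->|/IH l]; first exact: leq_maxl.
by rewrite (leq_trans l) // leq_maxr.
Qed.

(** A negated universal formula is accepted together with a counterexample, named by a variable
    fresh for the formula and for all that was accepted before. *)
Definition henkin_add (p : form) (G : list form) : list form :=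
  match p with
  | Imp (AllNum q) Bot => Not (instN (Var (freshN (p :: G))) q) :: p :: G
  | Imp (AllSet q) Bot => Not (instS (freshS (p :: G)) q) :: p :: G
  | _ => p :: G
  end.

Lemma henkin_add_sub p G q : List.In q (p :: G) -> List.In q (henkin_add p G).
Proof. by case: p => // -[] // r [] // h; right. Qed.

(** If the counterexample were refutable, the instance at the fresh variable would be derivable and
    would generalise to the universal formula that p denies. *)
Lemma henkin_add_consistent p G :
  ~ prv T (p :: G) Bot -> ~ prv T (henkin_add p G) Bot.
Proof.
case: p => // -[] // r [] // con; rewrite /henkin_add => pf; apply: con.
- set p := Imp _ _ in pf *.
  have /prv_freshN h := prv_raa _ _ _ pf.
  apply: (@prv_impE _ _ (AllNum r)); first by apply: prv_hyp; left.
  apply: h => q [<-|qG]; last exact: (@freshNP (p :: G)).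
  by apply: leq_trans (@freshNP (p :: G) p _); [exact: leq_maxl|left].
- set p := Imp _ _ in pf *.
  have /prv_freshS h := prv_raa _ _ _ pf.
  apply: (@prv_impE _ _ (AllSet r)); first by apply: prv_hyp; left.
  apply: h => q [<-|qG]; last exact: (@freshSP (p :: G)).
  by apply: leq_trans (@freshSP (p :: G) p _); [exact: leq_maxl|left].
Qed.

Fixpoint stage (n : nat) : list form :=
  match n with
  | 0 => G0
  | n.+1 => if unpickle n is Some p then
              if pselect (prv T (p :: stage n) Bot) then stage n
              else henkin_add p (stage n)
            else stage n
  end.

Lemma stage_consistent n : ~ prv T (stage n) Bot.
Proof.
elim: n => //= n IH; case: unpickle => // p; case: pselect => // con.
exact: henkin_add_consistent.
Qed.

Lemma stage_mono m n q : m <= n -> List.In q (stage m) -> List.In q (stage n).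
Proof.
elim: n => [|n IH]; first by rewrite leqn0 => /eqP ->.
rewrite leq_eqVlt => /orP [/eqP -> //|]; rewrite ltnS => /IH {}IH /IH /= h.
case: unpickle => // p; case: pselect => // con.
by apply: henkin_add_sub; right.
Qed.

Definition thy (p : form) : Prop := exists n, List.In p (stage n).

Lemma thy_stage G : (forall q, List.In q G -> thy q) ->
  exists n, forall q, List.In q G -> List.In q (stage n).
Proof.
elim: G => [|p G IH] h; first by exists 0.
have [n hn] := IH (fun q qG => h q (or_intror qG)).
have [m hm] := h p (or_introl erefl).
exists (maxn m n) => q [<-|/hn h'].
  by apply: stage_mono hm; apply: leq_maxl.
by apply: stage_mono h'; apply: leq_maxr.
Qed.

(** Each formula is tried at the stage numbered by its code: there it is accepted, with its
    counterexample if it has one, or refuted. *)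
Lemma stage_step p : (exists m n, stage n = henkin_add p (stage m)) \/
  exists m, prv T (p :: stage m) Bot.
Proof.
case: (pselect (prv T (p :: stage (pickle p)) Bot)) => [con|ncon].
  by right; exists (pickle p).
left; exists (pickle p), (pickle p).+1; rewrite /= pickleK; by case: pselect.
Qed.

Lemma stage_dec p : thy p \/ exists m, prv T (p :: stage m) Bot.
Proof.
case: (stage_step p) => [[m [n e]]|]; [left|by right].
by exists n; rewrite e; apply: henkin_add_sub; left.
Qed.

(** Otherwise some stage refutes p, and a later stage that also contains [G] is inconsistent. *)
Lemma thy_closed G p : (forall q, List.In q G -> thy q) -> prv T G p -> thy p.
Proof.
move=> Gthy pf; case: (stage_dec p) => // -[m incon].
have [n hn] := thy_stage Gthy; exfalso.
apply: (@stage_consistent (maxn m n)).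
apply: (@prv_impE _ _ p); last first.
  by apply: prv_weaken pf _ => q /hn; apply: stage_mono; apply: leq_maxr.
apply: prv_impI; apply: prv_weaken incon _ => q [->|h]; [by left|right].
by apply: stage_mono h; apply: leq_maxl.
Qed.

Lemma thy_Bot : ~ thy Bot.
Proof. by case=> n h; apply: (@stage_consistent n); apply: prv_hyp. Qed.

Lemma thy_Imp p q : thy (Imp p q) <-> (thy p -> thy q).
Proof.
split=> [pq tp|h].
  apply: (@thy_closed [:: Imp p q; p]) => [r [<-|[<-|[]]] //|].
  by apply: (@prv_impE _ _ p); apply: prv_hyp; [left|right; left].
case: (stage_dec p) => [/h tq|[m incon]].
  apply: (@thy_closed [:: q]) => [r [<-|[]] //|].
  by apply: prv_impI; apply: prv_hyp; right; left.
apply: (@thy_closed (stage m)) => [r|]; first by exists m.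
apply: prv_impI; apply: prv_raa; apply: prv_weaken incon _ => r h'.
by right.
Qed.

Lemma thy_Not p : thy (Not p) <-> ~ thy p.
Proof.
rewrite /Not thy_Imp; split=> h tp; [exact: thy_Bot (h tp)|by case: (h tp)].
Qed.

(** For the converse, the negation of the universal formula would be in the theory. At its own stage
    it came with a counterexample, unless it was refuted there, which contradicts the consistency of
    a later stage containing it. *)
Lemma thy_AllNum p : thy (AllNum p) <-> forall t, thy (instN t p).
Proof.
split=> [ap t|h].
  apply: (@thy_closed [:: AllNum p]) => [q [<-|[]] //|].
  by apply/prv_allNE/prv_hyp; left.
apply: contrapT => /thy_Not [n hn].
case: (stage_step (Not (AllNum p))) => [[m [k e]]|[m incon]].
  set t := freshN (Not (AllNum p) :: stage m).
  have /thy_Not : thy (Not (instN (Var t) p)) by exists k; rewrite e; left.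
  exact.
apply: (@stage_consistent (maxn n m)).
apply: prv_weaken incon _ => q [<-|]; last by apply: stage_mono; apply: leq_maxr.
by apply: stage_mono hn; apply: leq_maxl.
Qed.

Lemma thy_AllSet p : thy (AllSet p) <-> forall X, thy (instS X p).
Proof.
split=> [ap t|h].
  apply: (@thy_closed [:: AllSet p]) => [q [<-|[]] //|].
  by apply/prv_allSE/prv_hyp; left.
apply: contrapT => /thy_Not [n hn].
case: (stage_step (Not (AllSet p))) => [[m [k e]]|[m incon]].
  set t := freshS (Not (AllSet p) :: stage m).
  have /thy_Not : thy (Not (instS t p)) by exists k; rewrite e; left.
  exact.
apply: (@stage_consistent (maxn n m)).
apply: prv_weaken incon _ => q [<-|]; last by apply: stage_mono; apply: leq_maxr.
by apply: stage_mono hn; apply: leq_maxl.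
Qed.

Definition eqv (s t : term) : Prop := thy (Equ s t).

Lemma eqv_refl t : eqv t t.
Proof. by apply: (@thy_closed [::]) => //; apply: prv_eq_refl. Qed.

Lemma thy_eqv p s t : eqv s t -> thy (instN s p) -> thy (instN t p).
Proof.
move=> e h; apply: (@thy_closed [:: Equ s t; instN s p]) => [q [<-|[<-|[]]] //|].
by apply: (@prv_eq_subst _ _ p s); apply: prv_hyp; [left|right; left].
Qed.

Lemma tsubst_tshift t f s : tsubst (scons t f) (tshift s) = tsubst f s.
Proof. by rewrite /tshift tsubst_comp. Qed.

Lemma eqv_sym s t : eqv s t -> eqv t s.
Proof.
move=> /(@thy_eqv (Equ (Var 0) (tshift s))); rewrite /instN /= !tsubst_tshift !tsubst_var.
by apply; apply: eqv_refl.
Qed.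

Lemma eqv_trans s t u : eqv s t -> eqv t u -> eqv s u.
Proof.
move=> st /(@thy_eqv (Equ (tshift s) (Var 0))); rewrite /instN /= !tsubst_tshift !tsubst_var.
exact.
Qed.

(** Leibniz's rule for the formula c(s) = c(x) in the variable x. *)
Lemma eqv_tsubst c s t : eqv s t -> eqv (tsubst (scons s Var) c) (tsubst (scons t Var) c).
Proof.
move=> /(@thy_eqv (Equ (tshift (tsubst (scons s Var) c)) c)).
rewrite /instN /= !tsubst_tshift !tsubst_var; apply; exact: eqv_refl.
Qed.

Lemma eqv_op (op : term -> term -> term) s s' t t' :
  (forall f a b, tsubst f (op a b) = op (tsubst f a) (tsubst f b)) ->
  eqv s s' -> eqv t t' -> eqv (op s t) (op s' t').
Proof.
move=> opE es et; apply: (@eqv_trans _ (op s' t)).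
  have := eqv_tsubst (op (Var 0) (tshift t)) es.
  by rewrite !opE /= !tsubst_tshift !tsubst_var.
have := eqv_tsubst (op (tshift s') (Var 0)) et.
by rewrite !opE /= !tsubst_tshift !tsubst_var.
Qed.

(** Serves both atomic relations; membership is treated as a binary relation whose second argument
    is a dummy. *)
Lemma eqv_rel (P : term -> term -> form) s s' t t' :
  (forall f a b, subst f idS (P a b) = P (tsubst f a) (tsubst f b)) ->
  eqv s s' -> eqv t t' -> thy (P s t) -> thy (P s' t').
Proof.
move=> PE es et h.
have := thy_eqv (p := P (tshift s') (Var 0)) et.
rewrite /instN !PE /= !tsubst_tshift !tsubst_var; apply.
have := thy_eqv (p := P (Var 0) (tshift t)) es.
by rewrite /instN !PE /= !tsubst_tshift !tsubst_var; apply.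
Qed.

Notation cl := (class eqv).
Notation clE := (classE eqv_refl eqv_sym eqv_trans).
Notation clP := (reprP eqv_refl eqv_sym eqv_trans).

(** Set variables serve as sets without identification, since the language has no equality of
    sets. *)
Definition term_model : structure :=
  {| num := quotient eqv;
     numset := nat;
     s0 := cl Zero;
     s1 := cl One;
     sadd := fun a b => cl (Plus (repr a) (repr b));
     smul := fun a b => cl (Times (repr a) (repr b));
     slt := fun a b => thy (Less (repr a) (repr b));
     smem := fun a X => thy (Defs.Mem (repr a) X) |}.

Lemma teval_term_model f t :
  teval (M := term_model) (fun n => cl (f n)) t = cl (tsubst f t).
Proof.
elim: t => //= s -> t ->; apply/clE; apply: eqv_op => //; exact: clP.
Qed.

Lemma sat_term_model f g p :
  sat (M := term_model) (fun n => cl (f n)) g p <-> thy (subst f g p).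
Proof.
elim: p f g => /=.
- by move=> s t f g; rewrite !teval_term_model clE.
- move=> s t f g; rewrite !teval_term_model.
  by split; apply: eqv_rel => //; first [exact: clP|apply: eqv_sym; exact: clP].
- move=> t X f g; rewrite !teval_term_model.
  split.
    exact: (@eqv_rel (fun t _ => Defs.Mem t (g X)) _ _ Zero Zero _ (clP _) (eqv_refl _)).
  exact: (@eqv_rel (fun t _ => Defs.Mem t (g X)) _ _ Zero Zero _ (eqv_sym (clP _)) (eqv_refl _)).
- by move=> f g; split=> // /thy_Bot.
- by move=> p IHp q IHq f g; rewrite thy_Imp IHp IHq.
- have E t f : scons (cl t) (fun n => cl (f n)) = (fun n => cl (scons t f n)).
    by apply/funext => -[].
  move=> p IHp f g; rewrite thy_AllNum; split=> h t.
    by rewrite instN_up; apply/IHp; rewrite -E.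
  by rewrite -(classK t) E; apply/IHp; rewrite -instN_up.
- move=> p IHp f g; rewrite thy_AllSet; split=> h t.
    by rewrite instS_up; apply/IHp.
  by apply/IHp; rewrite -instS_up.
Qed.

Lemma term_model_models : models term_model T.
Proof.
move=> p Tp r v.
have -> : r = fun n => cl (repr (r n)) by apply/funext => n; rewrite classK.
apply/sat_term_model; apply: (@thy_closed [::]) => //; exact: prv_axiom_subst.
Qed.

End Henkin.

Theorem completeness (T : form -> Prop) (p : form) :
  (forall M, models M T -> forall r v, sat (M := M) r v p) -> provable T p.
Proof.
move=> valid; apply: contrapT => unprovable.
have con : ~ prv T [:: Not p] Bot by move=> /prv_raa.
have := valid _ (term_model_models con) (fun n => class _ (Var n)) idS.
move=> /(sat_term_model con); rewrite subst_var.
by apply/(thy_Not con); exists 0; left.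
Qed.

Import all_order all_algebra lra ring.
Import GRing.Theory Num.Theory Order.TTheory.
Local Open Scope ring_scope.

(** * The ordered field of fractions of a semiring *)

Section FractionField.
Variable R : comNzSemiRingType.
Hypothesis addI : forall a b c : R, a + c = b + c -> a = b.
Hypothesis mulI : forall a b c : R, a * (c + 1) = b * (c + 1) -> a = b.
Hypothesis total : forall a b : R, exists c, a + c = b \/ b + c = a.
Hypothesis conic : forall a b : R, a + b = 0 -> a = 0.
Hypothesis pred : forall a : R, a <> 0 -> exists b, a = b + 1.

(* [(m, n, p)] stands for [(m - n) / (p + 1)]. *)
Let triple : Type := R * R * R.

Definition fr_eq (x y : triple) : Prop :=
  x.1.1 * (y.2 + 1) + y.1.2 * (x.2 + 1) = y.1.1 * (x.2 + 1) + x.1.2 * (y.2 + 1).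

Lemma fr_refl x : fr_eq x x.
Proof. by rewrite /fr_eq; ring. Qed.

Lemma fr_sym x y : fr_eq x y -> fr_eq y x.
Proof. by rewrite /fr_eq => ->. Qed.

(** Scaled by [p3 + 1] and [p1 + 1], the two cross equations add up; then [addI] cancels the
    numerators of the middle triple and [mulI] its denominator. *)
Lemma fr_trans x y z : fr_eq x y -> fr_eq y z -> fr_eq x z.
Proof.
case: x y z => [[m1 n1] p1] [[m2 n2] p2] [[m3 n3] p3]; rewrite /fr_eq /= => h1 h2.
apply: (mulI (c := p2)).
apply: (addI (c := (n2 * (p1 + 1) + m2 * (p1 + 1)) * (p3 + 1))).
have e1 := congr1 (fun u => u * (p3 + 1)) h1.
have e2 := congr1 (fun u => u * (p1 + 1)) h2.
rewrite /= in e1 e2.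
transitivity ((m1 * (p2 + 1) + n2 * (p1 + 1)) * (p3 + 1)
              + (m2 * (p3 + 1) + n3 * (p2 + 1)) * (p1 + 1)); first by ring.
by rewrite e1 e2; ring.
Qed.

Definition fr : Type := quotient fr_eq.
HB.instance Definition _ := gen_eqMixin fr.
HB.instance Definition _ := gen_choiceMixin fr.

Let cl (x : triple) : fr := class fr_eq x.
Let clE x y : cl x = cl y <-> fr_eq x y := classE fr_refl fr_sym fr_trans x y.
Let clP x : fr_eq (repr (cl x)) x := reprP fr_refl fr_sym fr_trans x.

Definition add3 (x y : triple) : triple :=
  (x.1.1 * (y.2 + 1) + y.1.1 * (x.2 + 1), x.1.2 * (y.2 + 1) + y.1.2 * (x.2 + 1),
   x.2 * y.2 + x.2 + y.2).
Definition opp3 (x : triple) : triple := (x.1.2, x.1.1, x.2).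
Definition mul3 (x y : triple) : triple :=
  (x.1.1 * y.1.1 + x.1.2 * y.1.2, x.1.1 * y.1.2 + x.1.2 * y.1.1,
   x.2 * y.2 + x.2 + y.2).

Definition fr_add (x y : fr) : fr := cl (add3 (repr x) (repr y)).
Definition fr_opp (x : fr) : fr := cl (opp3 (repr x)).
Definition fr_mul (x y : fr) : fr := cl (mul3 (repr x) (repr y)).

Lemma fr_addE x y : fr_add (cl x) (cl y) = cl (add3 x y).
Proof.
apply/clE; move: (clP x) (clP y).
case: (repr (cl x)) (repr (cl y)) => [[m n] p] [[m' n'] p'].
case: x y => [[k l] q] [[k' l'] q'].
rewrite /fr_eq /= => h h'.
transitivity ((m * (q + 1) + l * (p + 1)) * (p' + 1) * (q' + 1)
              + (m' * (q' + 1) + l' * (p' + 1)) * (p + 1) * (q + 1)); first by ring.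
by rewrite h h'; ring.
Qed.

Lemma fr_oppE x : fr_opp (cl x) = cl (opp3 x).
Proof.
apply/clE; move: (clP x); case: (repr (cl x)) => [[m n] p]; case: x => [[k l] q].
by rewrite /fr_eq /= => h; rewrite addrC -h addrC.
Qed.

Lemma mul3C x y : mul3 x y = mul3 y x.
Proof.
by case: x y => [[m n] p] [[k l] q]; rewrite /mul3 /=; congr (_, _, _); ring.
Qed.

Lemma mul3_eq x x' y : fr_eq x x' -> fr_eq (mul3 x y) (mul3 x' y).
Proof.
case: x x' y => [[m n] p] [[m' n'] p'] [[k l] q]; rewrite /fr_eq /= => h.
transitivity ((q + 1) * (k * (m * (p' + 1) + n' * (p + 1))
                         + l * (m' * (p + 1) + n * (p' + 1)))); first by ring.
by rewrite h -{2}h; ring.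
Qed.

Lemma fr_mulE x y : fr_mul (cl x) (cl y) = cl (mul3 x y).
Proof.
apply/clE; apply: (@fr_trans _ (mul3 x (repr (cl y)))); first exact/mul3_eq/clP.
by rewrite mul3C (mul3C x); apply/mul3_eq/clP.
Qed.

Let opE := (fr_addE, fr_oppE, fr_mulE).
Let ind (P : fr -> Prop) : (forall m n p, P (cl (m, n, p))) -> forall x, P x.
Proof. by move=> h x; rewrite -(classK x); case: (repr x) => [[m n] p]; apply: h. Qed.

Fact fr_addA : associative fr_add.
Proof.
elim/ind=> m n p; elim/ind=> m' n' p'; elim/ind=> m'' n'' p''.
by rewrite !opE; apply/clE; rewrite /fr_eq /=; ring.
Qed.
Fact fr_addC : commutative fr_add.
Proof.
elim/ind=> m n p; elim/ind=> m' n' p'.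
by rewrite !opE; apply/clE; rewrite /fr_eq /=; ring.
Qed.
Fact fr_add0 : left_id (cl (0, 0, 0)) fr_add.
Proof. by elim/ind=> m n p; rewrite !opE; apply/clE; rewrite /fr_eq /=; ring. Qed.
Fact fr_addN : left_inverse (cl (0, 0, 0)) fr_opp fr_add.
Proof. by elim/ind=> m n p; rewrite !opE; apply/clE; rewrite /fr_eq /=; ring. Qed.

HB.instance Definition _ :=
  GRing.isZmodule.Build fr fr_addA fr_addC fr_add0 fr_addN.

Fact fr_mulA : associative fr_mul.
Proof.
elim/ind=> m n p; elim/ind=> m' n' p'; elim/ind=> m'' n'' p''.
by rewrite !opE; apply/clE; rewrite /fr_eq /=; ring.
Qed.
Fact fr_mulC : commutative fr_mul.
Proof. by elim/ind=> m n p; elim/ind=> m' n' p'; rewrite !opE mul3C. Qed.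
Fact fr_mul1 : left_id (cl (1, 0, 0)) fr_mul.
Proof. by elim/ind=> m n p; rewrite !opE; apply/clE; rewrite /fr_eq /=; ring. Qed.
Fact fr_mulDl : left_distributive fr_mul fr_add.
Proof.
elim/ind=> m n p; elim/ind=> m' n' p'; elim/ind=> m'' n'' p''.
by rewrite !opE; apply/clE; rewrite /fr_eq /=; ring.
Qed.
Fact fr_1neq0 : cl (1, 0, 0) != 0.
Proof.
apply/eqP => /clE; rewrite /fr_eq /= => h.
have : 1 = 0 :> R by ring: h.
by move/eqP; rewrite oner_eq0.
Qed.

HB.instance Definition _ :=
  GRing.Zmodule_isComNzRing.Build fr fr_mulA fr_mulC fr_mul1 fr_mulDl fr_1neq0.

(** [total] supplies the difference of the two numerators in one of the two directions; signs and
    inverses both rest on this normal form. *)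
Lemma cl_ge0_or_le0 (x : fr) : exists m p, x = cl (m, 0, p) \/ x = - cl (m, 0, p).
Proof.
elim/ind: x => m n p; have [c [e|e]] := total m n; exists c, p.
- by right; rewrite -e -[RHS]/(fr_opp _) opE; apply/clE; rewrite /fr_eq /=; ring.
- by left; rewrite -e; apply/clE; rewrite /fr_eq /=; ring.
Qed.

Lemma fr_inverse (x : fr) : x != 0 -> exists y, y * x = 1.
Proof.
suff pos m p : cl (m, 0, p) != 0 -> exists y, y * cl (m, 0, p) = 1.
  case: (cl_ge0_or_le0 x) => m [p [->|->]]; first exact: pos.
  by rewrite oppr_eq0 => /pos [y e]; exists (- y); rewrite mulrNN.
move=> nz; have [c e] : exists c, m = c + 1.
  apply: pred => m0; move/eqP: nz; apply; rewrite m0.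
  by apply/clE; rewrite /fr_eq /=; ring.
exists (cl (p + 1, 0, c)); rewrite -[LHS]/(fr_mul _ _) opE e.
by apply/clE; rewrite /fr_eq /=; ring.
Qed.

Definition fr_inv (x : fr) : fr :=
  if pselect (exists y, y * x = 1) is left h then projT1 (cid h) else 0.

Fact fr_mulV x : x != 0 -> fr_inv x * x = 1.
Proof.
by move/fr_inverse => h; rewrite /fr_inv; case: pselect => // {}h; case: cid.
Qed.
Fact fr_inv0 : fr_inv 0 = 0.
Proof.
rewrite /fr_inv; case: pselect => // h; exfalso; case: h => y /eqP.
by rewrite mulr0 eq_sym oner_eq0.
Qed.

HB.instance Definition _ := GRing.ComNzRing_isField.Build fr fr_mulV fr_inv0.

Definition fr_ge0 (x : fr) : bool := `[< exists m p, x = cl (m, 0, p) >].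
Definition fr_le (x y : fr) : bool := fr_ge0 (y - x).
Definition fr_lt (x y : fr) : bool := (y != x) && fr_le x y.
Definition fr_norm (x : fr) : fr := if fr_ge0 x then x else - x.

Fact fr_le0 x : fr_le 0 x = fr_ge0 x. Proof. by rewrite /fr_le subr0. Qed.

Fact fr_le0_add x y : fr_le 0 x -> fr_le 0 y -> fr_le 0 (x + y).
Proof.
rewrite !fr_le0 => /asboolP [m [p ->]] /asboolP [n [q ->]]; apply/asboolP.
exists (m * (q + 1) + n * (p + 1)), (p * q + p + q).
by rewrite -[LHS]/(fr_add _ _) opE; apply/clE; rewrite /fr_eq /=; ring.
Qed.
Fact fr_le0_mul x y : fr_le 0 x -> fr_le 0 y -> fr_le 0 (x * y).
Proof.
rewrite !fr_le0 => /asboolP [m [p ->]] /asboolP [n [q ->]]; apply/asboolP.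
exists (m * n), (p * q + p + q).
by rewrite -[LHS]/(fr_mul _ _) opE; apply/clE; rewrite /fr_eq /=; ring.
Qed.
(** If x = m/(p+1) and -x = n/(q+1), then m(q+1) + n(p+1) = 0; [conic] makes the first summand
    vanish, and [mulI] then gives m = 0. *)
Fact fr_le0_anti x : fr_le 0 x -> fr_le x 0 -> x = 0.
Proof.
rewrite fr_le0 /fr_le sub0r => /asboolP [m [p ->]] /asboolP [n [q]].
rewrite -[LHS]/(fr_opp _) opE => /clE; rewrite /fr_eq /= => e.
have m0 : m * (q + 1) = 0.
  apply: (conic (b := n * (p + 1))); transitivity (0 * (q + 1) + 0 * (p + 1) : R).
    by rewrite e addrC.
  by ring.
have -> : m = 0 by apply: (mulI (c := q)); rewrite m0 mul0r.
by apply/clE; rewrite /fr_eq /=; ring.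
Qed.
Fact fr_sub_ge0 x y : fr_le 0 (y - x) = fr_le x y. Proof. exact: fr_le0. Qed.
Fact fr_le0_total x : fr_le 0 x || fr_le x 0.
Proof.
rewrite fr_le0 /fr_le sub0r; apply/orP.
case: (cl_ge0_or_le0 x) => m [p [->|->]]; [left|right; rewrite opprK];
  by apply/asboolP; exists m, p.
Qed.
Fact fr_normN x : fr_norm (- x) = fr_norm x.
Proof.
rewrite /fr_norm; case: ifP => h; case: ifP => h' //; rewrite ?opprK //.
- have -> : x = 0; last by rewrite oppr0.
  by apply: fr_le0_anti; rewrite ?fr_le0 // /fr_le sub0r.
- by have := fr_le0_total x; rewrite fr_le0 /fr_le sub0r h h'.
Qed.
Fact fr_ge0_norm x : fr_le 0 x -> fr_norm x = x.
Proof. by rewrite fr_le0 /fr_norm => ->. Qed.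

HB.instance Definition _ := Num.IntegralDomain_isLeReal.Build fr
  fr_le0_add fr_le0_mul fr_le0_anti fr_sub_ge0 fr_le0_total fr_normN fr_ge0_norm
  (fun x y => erefl (fr_lt x y)).

(** The last clause makes the field Archimedean relative to [R], though possibly not relative to the
    standard integers: it has no positive element below all 1/(p+1). *)
Theorem fraction_field : exists (K : realFieldType) (i : R -> K),
  [/\ i 0 = 0, i 1 = 1, {morph i : a b / a + b}, {morph i : a b / a * b}
    & [/\ injective i, forall a, 0 <= i a
    & forall x, 0 <= x -> exists m p, x = i m / (i p + 1)]].
Proof.
have iD : {morph (fun a => cl (a, 0, 0)) : a b / a + b >-> a + b : fr}.
  move=> a b; rewrite -[RHS]/(fr_add _ _) opE.
  by apply/clE; rewrite /fr_eq /=; ring.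
have ge0 m p : 0 <= cl (m, 0, p) :> fr.
  by rewrite -[_ <= _]/(fr_le _ _) fr_le0; apply/asboolP; exists m, p.
exists fr, (fun a => cl (a, 0, 0)); split=> //.
  move=> a b; rewrite -[RHS]/(fr_mul _ _) opE.
  by apply/clE; rewrite /fr_eq /=; ring.
split=> // [a b /clE|x]; first by rewrite /fr_eq /= => h; ring: h.
rewrite -[_ <= _]/(fr_le _ _) fr_le0 => /asboolP [m [p ->]]; exists m, p.
have nz : cl (p, 0, 0) + 1 != 0 :> fr by rewrite gt_eqF // ltr_wpDl.
apply: (mulIf nz); rewrite divfK //.
rewrite -[_ + 1]/(fr_add _ _) opE -[LHS]/(fr_mul _ _) opE.
by apply/clE; rewrite /fr_eq /=; ring.
Qed.

End FractionField.

(** * Arithmetic in a model *)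

Section Model.
Variable M : structure.
Hypothesis M_RCA0 : models M RCA0.
(** Default value for lists of sets; any valuation of the set variables provides one. *)
Variable X0 : numset M.

Definition nn : Type := num M.
Local Notation N := nn.
Local Notation "a ⊕ b" := (sadd a b) (at level 50, left associativity).
Local Notation "a ⊗ b" := (smul a b) (at level 40, left associativity).
Definition nlt : N -> N -> Prop := @slt M.
Local Notation "a ≺ b" := (nlt a b) (at level 70, no associativity).
Local Notation o := (s0 M).
Local Notation u := (s1 M).

(** * Derived connectives and definable predicates in a model *)

Lemma sat_And r v p q : sat (M := M) r v (And p q) <-> sat r v p /\ sat r v q.
Proof.
rewrite /And /Not /=; split=> [h|[hp hq] h]; last exact: h hp hq.
by split; apply: contrapT => n; apply: h => // hp.
Qed.

Lemma sat_Or r v p q : sat (M := M) r v (Or p q) <-> sat r v p \/ sat r v q.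
Proof.
rewrite /Or /Not /=; split=> [h|[hp n|hq _]] //.
by case: (EM (sat r v p)) => hp; [left|right; apply: h].
Qed.

Lemma sat_Iff r v p q : sat (M := M) r v (Iff p q) <-> (sat r v p <-> sat r v q).
Proof. by rewrite /Iff sat_And /=; split=> [[]|[]]. Qed.

Lemma sat_ExNum r v p : sat (M := M) r v (ExNum p) <-> exists x, sat (scons x r) v p.
Proof.
rewrite /ExNum /Not /=; split=> [h|[x hx] h]; last exact: h x hx.
by apply: contrapT => n; apply: h => x hx; apply: n; exists x.
Qed.

Lemma sat_ExSet r v p : sat (M := M) r v (ExSet p) <-> exists X, sat r (scons X v) p.
Proof.
rewrite /ExSet /Not /=; split=> [h|[x hx] h]; last exact: h x hx.
by apply: contrapT => n; apply: h => x hx; apply: n; exists x.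
Qed.

(* Definability is expressed on predicates over lists of numbers, which stand
   for the values of the de Bruijn variables; all other elements and sets of
   [M] may occur as constants. *)
Inductive isT : (seq N -> N) -> Prop :=
| isT_const c : isT (fun=> c)
| isT_nth i : isT (fun e => nth o e i)
| isT_add s t : isT s -> isT t -> isT (fun e => s e ⊕ t e)
| isT_mul s t : isT s -> isT t -> isT (fun e => s e ⊗ t e).

Inductive isD0 : (seq N -> Prop) -> Prop :=
| isD0_eq s t : isT s -> isT t -> isD0 (fun e => s e = t e)
| isD0_lt s t : isT s -> isT t -> isD0 (fun e => s e ≺ t e)
| isD0_mem t X : isT t -> isD0 (fun e => smem (t e) X)
| isD0_False : isD0 (fun=> False)
| isD0_imp P Q : isD0 P -> isD0 Q -> isD0 (fun e => P e -> Q e)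
| isD0_ball t P : isT t -> isD0 P -> isD0 (fun e => forall y, y ≺ t e -> P (y :: e)).

Definition isS1 (P : seq N -> Prop) : Prop :=
  exists2 Q, isD0 Q & forall e, P e <-> exists y, Q (y :: e).

Lemma In_nth (T : Type) (x0 x : T) l : List.In x l -> exists i, nth x0 l i = x.
Proof.
by elim: l => //= y l IH [->|/IH [i <-]]; [exists 0%N|exists i.+1].
Qed.

(** Constants become extra variables, placed in a list after the d genuine ones. The claim holds for
    every list that contains the needed constants, so that subterms can share one list. *)
Lemma isT_term t : isT t -> exists l, forall l', List.incl l l' -> forall d,
  exists s, forall e, size e = d -> teval (nth o (e ++ l')) s = t e.
Proof.
elim=> {t} [c|i|s t _ [l1 h1] _ [l2 h2]|s t _ [l1 h1] _ [l2 h2]].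
- exists [:: c] => l' /(_ c) h d; have [|i hi] := In_nth o (l := l') (x := c).
    by apply: h; left.
  exists (Var (d + i)) => e se /=.
  by rewrite nth_cat se ltnNge leq_addr /= addKn.
(* Beyond the length of e the value is the default [o], hence [Zero]; the variable i would read a
   parameter. *)
- exists [::] => l' _ d; exists (if (i < d)%N then Var i else Zero) => e se.
  case: ltnP => h /=; first by rewrite nth_cat se h.
  by rewrite nth_default // se.
- exists (l1 ++ l2) => l' /List.incl_app_inv [i1 i2] d.
  have [p hp] := h1 _ i1 d; have [q hq] := h2 _ i2 d.
  by exists (Plus p q) => e se /=; rewrite hp // hq.
- exists (l1 ++ l2) => l' /List.incl_app_inv [i1 i2] d.
  have [p hp] := h1 _ i1 d; have [q hq] := h2 _ i2 d.
  by exists (Times p q) => e se /=; rewrite hp // hq.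
Qed.

Lemma scons_nth T (x0 x : T) l : scons x (nth x0 l) = nth x0 (x :: l).
Proof. by apply/funext => -[]. Qed.

Lemma isD0_form P : isD0 P -> exists l m, forall l' m',
  List.incl l l' -> List.incl m m' -> forall d, exists2 p, Delta0 p &
  forall e, size e = d -> sat (nth o (e ++ l')) (nth X0 m') p <-> P e.
Proof.
elim=> {P} [s t /isT_term [l1 h1] /isT_term [l2 h2]
           |s t /isT_term [l1 h1] /isT_term [l2 h2]
           |t X /isT_term [l1 h1]
           |
           |P Q _ [l1 [m1 h1]] _ [l2 [m2 h2]]
           |t P /isT_term [l1 h1] _ [l2 [m2 h2]]].
- exists (l1 ++ l2), [::] => l' m' /List.incl_app_inv [i1 i2] _ d.
  have [p hp] := h1 _ i1 d; have [q hq] := h2 _ i2 d.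
  by exists (Equ p q); [constructor|move=> e se /=; rewrite hp // hq].
- exists (l1 ++ l2), [::] => l' m' /List.incl_app_inv [i1 i2] _ d.
  have [p hp] := h1 _ i1 d; have [q hq] := h2 _ i2 d.
  by exists (Less p q); [constructor|move=> e se /=; rewrite hp // hq].
- exists l1, [:: X] => l' m' i1 i2 d; have [p hp] := h1 _ i1 d.
  have [|i hi] := In_nth X0 (l := m') (x := X); first by apply: i2; left.
  by exists (Defs.Mem p i); [constructor|move=> e se /=; rewrite hp // hi].
- by exists [::], [::] => l' m' _ _ d; exists Bot; first constructor.
- exists (l1 ++ l2), (m1 ++ m2).
  move=> l' m' /List.incl_app_inv [i1 i2] /List.incl_app_inv [j1 j2] d.
  have [p Dp hp] := h1 _ _ i1 j1 d; have [q Dq hq] := h2 _ _ i2 j2 d.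
  by exists (Imp p q); [constructor|move=> e se /=; rewrite hp // hq].
- exists (l1 ++ l2), m2 => l' m' /List.incl_app_inv [i1 i2] j2 d.
  have [p hp] := h1 _ i1 d; have [q Dq hq] := h2 _ _ i2 j2 d.+1.
  exists (AllNum (Imp (Less (Var 0) (tshift p)) q)); first by constructor.
  move=> e se /=; split=> h y.
  - move: (h y); rewrite teval_tshift hp // => {}h /h.
    by rewrite scons_nth -cat_cons hq //= se.
  - rewrite teval_tshift hp // => /h.
    by rewrite scons_nth -cat_cons hq //= se.
Qed.

Definition hd : seq N -> N := head o.

Lemma S1_induction (P : N -> Prop) : isS1 (fun e => P (hd e)) ->
  P o -> (forall x, P x -> P (x ⊕ u)) -> forall x, P x.
Proof.
move=> [Q /isD0_form [l [m h]] PE] Po PS.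
have [q Dq qE] := h l m (fun _ => id) (fun _ => id) 2.
have pE x : sat (scons x (nth o l)) (nth X0 m) (ExNum q) <-> P x.
  rewrite sat_ExNum (PE [:: x]).
  by split=> -[y hy]; exists y; move: hy; rewrite !scons_nth => /(qE [:: y; x] erefl).
have ind : sat (nth o l) (nth X0 m)
      (And (instN Zero (ExNum q)) (AllNum (Imp (ExNum q)
        (subst (scons (Plus (Var 0) One) (fun n => Var n.+1)) idS (ExNum q))))) ->
    forall x, sat (scons x (nth o l)) (nth X0 m) (ExNum q) :=
  M_RCA0 (Sigma1_induction _ (Sigma1_intro _ Dq)) (nth o l) (nth X0 m).
move=> x; apply/pE; apply: ind x; apply/sat_And; split.
  apply/sat_subst; move/pE: Po; congr sat; by apply/funext => -[].
move=> x; set q' := subst _ _ _.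
change (sat (scons x (nth o l)) (nth X0 m) (ExNum q) ->
        sat (scons x (nth o l)) (nth X0 m) q') => /pE /PS /pE hx.
by apply/sat_subst; move: hx; congr sat; apply/funext => -[].
Qed.

(** The Pi-1 form of [P] demanded by the axiom is the negation of the Sigma-1 form of its
    complement. *)
Lemma D1_comprehension (P : N -> Prop) :
  isS1 (fun e => P (hd e)) -> isS1 (fun e => ~ P (hd e)) ->
  exists X, forall x, smem x X <-> P x.
Proof.
move=> [Q1 /isD0_form [l1 [m1 h1]] PE] [Q2 /isD0_form [l2 [m2 h2]] nPE].
pose l := l1 ++ l2; pose m := m1 ++ m2.
have [p Dp pE] := h1 l m (List.incl_appl _ (fun _ => id))
                        (List.incl_appl _ (fun _ => id)) 2.
have [q Dq qE] := h2 l m (List.incl_appr _ (fun _ => id))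
                        (List.incl_appr _ (fun _ => id)) 2.
have {}pE x : sat (scons x (nth o l)) (nth X0 m) (ExNum p) <-> P x.
  rewrite sat_ExNum (PE [:: x]).
  by split=> -[y hy]; exists y; move: hy; rewrite !scons_nth => /(pE [:: y; x] erefl).
have {}qE x : sat (scons x (nth o l)) (nth X0 m) (AllNum (Not q)) <-> P x.
  rewrite /Not /=; split=> [h|Px y].
    apply: contrapT => /(nPE [:: x]) [y hy]; apply: (h y).
    by rewrite !scons_nth; apply/(qE [:: y; x] erefl).
  rewrite !scons_nth => /(qE [:: y; x] erefl) hy.
  by apply/(nPE [:: x]): Px; exists y.
have Dnq : Delta0 (Not q) := Delta0_imp _ _ Dq Delta0_bot.
have comp : (forall x, sat (scons x (nth o l)) (nth X0 m)
                         (Iff (ExNum p) (AllNum (Not q)))) ->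
    sat (nth o l) (nth X0 m)
      (ExSet (AllNum (Iff (Defs.Mem (Var 0) 0) (shiftS (ExNum p))))) :=
  M_RCA0 (Delta1_comprehension _ _ (Sigma1_intro _ Dp) (Pi1_intro _ Dnq)) _ _.
have /sat_ExSet [X hX] := comp (fun x => proj2 (sat_Iff _ _ _ _) (iff_trans (pE x) (iff_sym (qE x)))).
exists X => x; have : sat (scons x (nth o l)) (scons X (nth X0 m))
  (Iff (Defs.Mem (Var 0) 0) (shiftS (ExNum p))) := hX x.
move=> /sat_Iff h; apply: iff_trans h _; apply: iff_trans (sat_subst _ _ _ _ _) _.
by rewrite -pE; split; congr sat; apply/funext => -[].
Qed.

Lemma isD0_ext P Q : (forall e, P e <-> Q e) -> isD0 P -> isD0 Q.
Proof. by move=> PQ; rewrite (_ : P = Q) //; apply/funext => e; apply/propext. Qed.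

Lemma isS1_ext P Q : (forall e, P e <-> Q e) -> isS1 P -> isS1 Q.
Proof. by move=> PQ; rewrite (_ : P = Q) //; apply/funext => e; apply/propext. Qed.

(** The quantifier lemmas below reach a variable as [hd] of an iterated [behead]; this class
    recognises such accesses. *)
Definition isTail (f : seq N -> seq N) : Prop := exists i, forall e, f e = drop i e.

Lemma isTail_id : isTail (fun e => e).
Proof. by exists 0%N => e; rewrite drop0. Qed.

Lemma isTail_behead f : isTail f -> isTail (fun e => behead (f e)).
Proof. by move=> [i h]; exists i.+1 => e; rewrite h -drop1 drop_drop. Qed.

Lemma isT_hd f : isTail f -> isT (fun e => hd (f e)).
Proof.
move=> [i h]; rewrite (_ : (fun e => _) = fun e => nth o e i); first exact: isT_nth.
by apply/funext => e; rewrite h /hd -nth0 nth_drop addn0.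
Qed.

Definition isSub (f : seq N -> seq N) : Prop := forall i, isT (fun e => nth o (f e) i).

Lemma isT_sub t f : isT t -> isSub f -> isT (fun e => t (f e)).
Proof.
move=> ht hf; elim: ht => [c|i|s s' _ hs _ hs'|s s' _ hs _ hs'].
- exact: isT_const.
- exact: hf.
- exact: isT_add.
- exact: isT_mul.
Qed.

Lemma isSub_tail f : isTail f -> isSub f.
Proof.
move=> [i h] j; rewrite (_ : (fun e => _) = fun e => nth o e (i + j)).
  exact: isT_nth.
by apply/funext => e; rewrite h nth_drop.
Qed.

Lemma isSub_cons t f : isT t -> isSub f -> isSub (fun e => t e :: f e).
Proof. by move=> ht hf [|i] /=; [apply: ht|apply: hf]. Qed.

Lemma isD0_sub P f : isD0 P -> isSub f -> isD0 (fun e => P (f e)).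
Proof.
move=> hP; elim: hP f => {P}.
- by move=> s t hs ht f hf; apply: isD0_eq; apply: isT_sub.
- by move=> s t hs ht f hf; apply: isD0_lt; apply: isT_sub.
- by move=> t X ht f hf; apply: isD0_mem; apply: isT_sub.
- by move=> *; apply: isD0_False.
- by move=> P Q _ IHP _ IHQ f hf; apply: isD0_imp; [apply: IHP|apply: IHQ].
- move=> t P ht _ IH f hf.
  apply: (@isD0_ball (fun e => t (f e)) (fun e => P (hd e :: f (behead e)))).
    exact: isT_sub.
  apply: IH; apply: isSub_cons; first exact/isT_hd/isTail_id.
  by move=> i; apply: (isT_sub (hf i)); apply/isSub_tail/isTail_behead/isTail_id.
Qed.

Lemma isD0_not P : isD0 P -> isD0 (fun e => ~ P e).
Proof. by move=> h; apply: isD0_imp h isD0_False. Qed.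

Lemma isD0_and P Q : isD0 P -> isD0 Q -> isD0 (fun e => P e /\ Q e).
Proof.
move=> hP hQ; apply: isD0_ext (isD0_not (isD0_imp hP (isD0_not hQ))) => e.
split=> [h|[p q] h]; last exact: h p q.
by split; apply: contrapT => n; apply: h => // p.
Qed.

Lemma isD0_or P Q : isD0 P -> isD0 Q -> isD0 (fun e => P e \/ Q e).
Proof.
move=> hP hQ; apply: isD0_ext (isD0_imp (isD0_not hP) hQ) => e.
by split=> [h|[]//]; case: (EM (P e)) => p; [left|right; apply: h].
Qed.

Lemma isD0_forall t P : isT t -> isD0 (fun e => P (behead e) (hd e)) ->
  isD0 (fun e => forall y, y ≺ t e -> P e y).
Proof. exact: isD0_ball. Qed.

Lemma isD0_exists t P : isT t -> isD0 (fun e => P (behead e) (hd e)) ->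
  isD0 (fun e => exists y, y ≺ t e /\ P e y).
Proof.
move=> ht hP.
have := isD0_not (@isD0_forall t (fun e y => ~ P e y) ht (isD0_not hP)).
apply: isD0_ext => e; split=> [h|[y [l p]] h]; last exact: h y l p.
by apply: contrapT => n; apply: h => y l p; apply: n; exists y.
Qed.

Lemma isS1_exD0 P : isD0 (fun e => P (behead e) (hd e)) -> isS1 (fun e => exists y, P e y).
Proof. by exists (fun e => P (behead e) (hd e)). Qed.

Lemma isS1_D0 P : isD0 P -> isS1 P.
Proof.
move=> hP; exists (fun e => P (behead e)).
  by apply: isD0_sub hP _; apply/isSub_tail/isTail_behead/isTail_id.
by move=> e; split=> [p|[]//]; exists o.
Qed.

(** Definability goals are discharged by recursion on the syntax. This version handles the raw
    operations of [M]; after the semiring structure is declared, [T_tac] and [D_tac] take over. *)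
Ltac tail_tac := first [exact: isTail_id | apply: isTail_behead; tail_tac].
Ltac T_base := first
  [ apply: isT_const | apply: isT_hd; tail_tac
  | (apply: isT_add; T_base) | (apply: isT_mul; T_base) ].
Ltac D_base := cbv beta; first
  [ apply: isD0_not; D_base | apply: isD0_and; D_base | apply: isD0_or; D_base
  | apply: isD0_forall; [T_base|D_base] | apply: isD0_exists; [T_base|D_base]
  | apply: isD0_imp; D_base | apply: isD0_eq; T_base | apply: isD0_lt; T_base
  | apply: isD0_mem; T_base | exact: isD0_False ].

(** * The numbers of a model form a discretely ordered semiring *)

Let ax p (h : RCA0 p) f : sat (M := M) (nth o f) (fun=> X0) p := M_RCA0 h _ _.

Fact add0 x : x ⊕ o = x. Proof. exact: (ax PA_add0 [:: x]). Qed.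
Fact addS x y : x ⊕ (y ⊕ u) = (x ⊕ y) ⊕ u.
Proof. exact: (ax PA_addS [:: x; y]). Qed.
Fact mul0 x : x ⊗ o = o. Proof. exact: (ax PA_mul0 [:: x]). Qed.
Fact mulS x y : x ⊗ (y ⊕ u) = (x ⊗ y) ⊕ x.
Proof. exact: (ax PA_mulS [:: x; y]). Qed.
Fact succ_neq0 x : x ⊕ u <> o. Proof. exact: (ax PA_succ_neq0 [:: x]). Qed.
Fact succ_inj x y : x ⊕ u = y ⊕ u -> x = y.
Proof. exact: (ax PA_succ_inj [:: x; y]). Qed.
Fact lt0 x : ~ x ≺ o. Proof. exact: (ax PA_lt0 [:: x]). Qed.
Fact ltS x y : x ≺ y ⊕ u <-> x ≺ y \/ x = y.
Proof. by have /sat_Iff := ax PA_ltS [:: x; y]; rewrite sat_Or. Qed.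

Lemma D0_induction (P : N -> Prop) : isD0 (fun e => P (hd e)) ->
  P o -> (forall x, P x -> P (x ⊕ u)) -> forall x, P x.
Proof. by move/isS1_D0; apply: S1_induction. Qed.

Fact add0n : left_id o (@sadd M : N -> N -> N).
Proof. by apply: D0_induction => [||x IH]; [D_base|exact: add0|rewrite addS IH]. Qed.

Fact addSn x y : (x ⊕ u) ⊕ y = (x ⊕ y) ⊕ u.
Proof.
by move: y; apply: D0_induction => [||y IH]; [D_base|rewrite !add0|rewrite !addS IH].
Qed.

Fact addnC : commutative (@sadd M : N -> N -> N).
Proof.
move=> x; apply: D0_induction => [||y IH]; first by D_base.
  by rewrite add0 add0n.
by rewrite addS addSn IH.
Qed.

Fact addnA : associative (@sadd M : N -> N -> N).
Proof.
move=> x y; apply: D0_induction => [||z IH]; first by D_base.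
  by rewrite !add0.
by rewrite !addS IH.
Qed.

HB.instance Definition _ := gen_eqMixin nn.
HB.instance Definition _ := gen_choiceMixin nn.
HB.instance Definition _ := GRing.isNmodule.Build nn addnA addnC add0n.

Fact mul0n : left_zero o (@smul M : N -> N -> N).
Proof.
by apply: D0_induction => [||x IH]; [D_base|rewrite mul0|rewrite mulS IH add0].
Qed.

Fact mulSn x y : (x ⊕ u) ⊗ y = x ⊗ y ⊕ y.
Proof.
move: y; apply: D0_induction => [||y IH]; [D_base|by rewrite !mul0 add0|].
by rewrite !mulS IH; apply: (@addrACA nn).
Qed.

Fact mulnC : commutative (@smul M : N -> N -> N).
Proof.
move=> x; apply: D0_induction => [||y IH]; first by D_base.
  by rewrite mul0 mul0n.
by rewrite mulS mulSn IH.
Qed.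

Fact mulnDl : left_distributive (@smul M : N -> N -> N) (@sadd M).
Proof.
move=> x y; apply: D0_induction => [||z IH]; first by D_base.
  by rewrite !mul0 add0.
by rewrite !mulS IH; apply: (@addrACA nn).
Qed.

Fact mulnA : associative (@smul M : N -> N -> N).
Proof.
move=> x y; apply: D0_induction => [||z IH]; first by D_base.
  by rewrite !mul0.
by rewrite !mulS -IH ![x ⊗ (_ ⊕ _)]mulnC mulnDl; congr sadd; apply: mulnC.
Qed.

Fact mul1n : left_id u (@smul M : N -> N -> N).
Proof. by move=> x; rewrite -{1}(add0n u) mulSn mul0n add0n. Qed.

Fact one_neq0 : u != o :> nn.
Proof. by apply/eqP => e; apply: (@succ_neq0 o); rewrite add0n. Qed.

HB.instance Definition _ := GRing.Nmodule_isComNzSemiRing.Build nn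
  mulnA mulnC mul1n mulnDl mul0n one_neq0.

Lemma isT_addr s t : isT s -> isT t -> isT (fun e => s e + t e).
Proof. exact: isT_add. Qed.
Lemma isT_mulr s t : isT s -> isT t -> isT (fun e => s e * t e).
Proof. exact: isT_mul. Qed.

Ltac T_tac := first
  [ apply: isT_const | apply: isT_hd; tail_tac
  | (apply: isT_addr; T_tac) | (apply: isT_mulr; T_tac) ].
Ltac D_tac := cbv beta; first
  [ apply: isD0_not; D_tac | apply: isD0_and; D_tac | apply: isD0_or; D_tac
  | apply: isD0_forall; [T_tac|D_tac] | apply: isD0_exists; [T_tac|D_tac]
  | apply: isD0_imp; D_tac | apply: isD0_eq; T_tac | apply: isD0_lt; T_tac
  | apply: isD0_mem; T_tac | exact: isD0_False ].

Fact nn_ind (P : nn -> Prop) : isS1 (fun e => P (hd e)) ->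
  P 0 -> (forall x, P x -> P (x + 1)) -> forall x, P x.
Proof. exact: S1_induction. Qed.

Fact nn_addI (a b c : nn) : a + c = b + c -> a = b.
Proof.
move: c; apply: nn_ind => [||c IH]; first by apply: isS1_D0; D_tac.
  by rewrite !addr0.
by rewrite !addrA => /succ_inj /IH.
Qed.

Fact nn_pred (a : nn) : a <> 0 -> exists b, a = b + 1.
Proof.
move: a; apply: nn_ind => [||a _ _]; last by exists a.
  (* The hypothesis is moved under the quantifier to make the induction formula visibly Sigma-1. *)
  by apply: (@isS1_ext (fun e => exists b, hd e <> o -> hd e = b + 1));
    [move=> e; split=> [[b h] /h|h]; [exists b|
       case: (EM (hd e = 0)) => [z|/h [b]]; [exists 0 => /(_ z)|exists b]]
    |apply: isS1_exD0; D_tac].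
by move=> h; case: h.
Qed.

Fact nn_total (a b : nn) : exists c, a + c = b \/ b + c = a.
Proof.
move: b; apply: nn_ind => [||b [c [e|e]]]; first by apply: isS1_exD0; D_tac.
- by exists a; right; rewrite add0r.
- by exists (c + 1); left; rewrite addrA e.
- case: (EM (c = 0)) => [c0|/nn_pred [d cd]].
    by exists 1; left; rewrite -e c0 addr0.
  by exists d; right; rewrite -e cd; ring.
Qed.

Fact nn_conic (a b : nn) : a + b = 0 -> a = 0.
Proof.
move=> e; apply: contrapT => /nn_pred [c ac]; move: e; rewrite ac addrAC.
exact: succ_neq0.
Qed.

Fact nn_mulI (a b c : nn) : a * (c + 1) = b * (c + 1) -> a = b.
Proof.
wlog [d e] : a b / exists d, a + d = b.
  move=> wl; case: (nn_total a b) => d [e|e] h; first by apply: (wl a b) => //; exists d.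
  by apply/esym/wl => //; exists d.
rewrite -e mulrDl => h.
have {}h : d * (c + 1) = 0.
  by apply: (@nn_addI _ _ (a * (c + 1))); rewrite add0r addrC -h.
by rewrite (@nn_conic d (d * c)) ?addr0 // -h; ring.
Qed.

Fact nn_lt (a b : nn) : a ≺ b <-> exists c, a + c + 1 = b.
Proof.
split=> [|[c <-]].
  (* Again the implication goes below the existential quantifier, for the sake of Sigma-1
     induction. *)
  suff [c h] : exists c, a ≺ b -> a + c + 1 = b by move/h; exists c.
  move: b; apply: nn_ind => [||b [c IH]]; first by apply: isS1_exD0; D_tac.
    by exists 0 => /lt0.
  case: (EM (a ≺ b)) => [/IH e|n]; first by exists (c + 1) => _; rewrite -e; ring.
  by exists 0 => /ltS [//|->]; rewrite addr0.
move: c; apply: nn_ind => [||c IH]; first by apply: isS1_D0; D_tac.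
  by apply/ltS; right; rewrite addr0.
by apply/ltS; left; rewrite addrA.
Qed.

Lemma isD0_app P t : isD0 (fun e => P (hd e)) -> isT t -> isD0 (fun e => P (t e)).
Proof.
move=> hP ht; apply: (isD0_sub (f := fun e => [:: t e]) hP).
by apply: isSub_cons => // i; rewrite (_ : (fun e => _) = fun=> o);
  [exact: isT_const|apply/funext => e; rewrite nth_nil].
Qed.

Definition npair (a b : nn) : nn := (a + b) * (a + b) + a.
Local Notation "⟨ a , b ⟩" := (npair a b).
Lemma isT_npair s t : isT s -> isT t -> isT (fun e => ⟨s e, t e⟩).
Proof.
by move=> hs ht; apply: isT_addr => //; apply: isT_mulr; apply: isT_addr.
Qed.

Ltac T_tac ::= first
  [ apply: isT_const | apply: isT_hd; tail_tac
  | (apply: isT_npair; T_tac)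
  | (apply: isT_addr; T_tac) | (apply: isT_mulr; T_tac) ].

Local Notation "x ∈ X" := (smem (x : nn) X) (at level 70).

(** * Transfer of the order and of pairing to the field of fractions *)

Section Field.
Variables (K : realFieldType) (i : nn -> K).
Hypotheses (i0 : i 0 = 0) (i1 : i 1 = 1) (iD : {morph i : a b / a + b}).
Hypotheses (iM : {morph i : a b / a * b}) (i_inj : injective i).
Hypothesis i_ge0 : forall a, 0 <= i a.
Hypothesis i_frac : forall x, 0 <= x -> exists m p, x = i m / (i p + 1).

Let iE := (i0, i1, iD, iM).

Lemma i_lt (a b : nn) : a ≺ b <-> i a < i b.
Proof.
rewrite nn_lt; split=> [[c <-]|h].
  by rewrite !iE; have := i_ge0 c; lra.
have [c [e|e]] := nn_total a b.
  have [d dc] : exists d, c = d + 1.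
    by apply: nn_pred => c0; move: h; rewrite -e c0 addr0 ltxx.
  by exists d; rewrite -e dc addrA.
by move: h; rewrite -e iE; have := i_ge0 c; lra.
Qed.

Lemma i_leS (a b : nn) : a ≺ b + 1 <-> i a <= i b.
Proof.
rewrite i_lt; split=> [/i_lt/ltS [/i_lt/ltW //|-> //]|].
by rewrite !iE; lra.
Qed.

Lemma i_succ_le a b : i a < i b -> i a + 1 <= i b.
Proof. by move=> /i_lt /nn_lt [c <-]; rewrite !iE; have := i_ge0 c; lra. Qed.

Lemma i_sub a b : i b <= i a -> exists c, i c = i a - i b.
Proof.
move=> h; have [c [e|e]] := nn_total a b; last by exists c; rewrite -e iE; ring.
exists 0; move: h; rewrite -e !iE; have := i_ge0 c; lra.
Qed.

(** With s = a + b, the code lies between s^2 and s^2 + s, hence below (s+1)^2. This determines s,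
    and then a. *)
Lemma npair_inj a b a' b' : ⟨a, b⟩ = ⟨a', b'⟩ -> a = a' /\ b = b'.
Proof.
move=> /(congr1 i); rewrite /npair !iE => h.
have [[[a0 b0] a0'] b0'] := (i_ge0 a, i_ge0 b, i_ge0 a', i_ge0 b').
have [l|l|e] := ltgtP (i a + i b) (i a' + i b').
- have : i (a + b) + 1 <= i (a' + b') by apply: i_succ_le; rewrite !iE.
  by rewrite !iE => l'; exfalso; nra.
- have : i (a' + b') + 1 <= i (a + b) by apply: i_succ_le; rewrite !iE.
  by rewrite !iE => l'; exfalso; nra.
- by split; apply: i_inj; move: h; rewrite e; lra.
Qed.

Lemma i_sqr a : i a <= i a * i a.
Proof.
have [-> |/eqP nz] := eqVneq (i a) 0; first by rewrite mul0r.
have : 0 + 1 <= i a by rewrite -i0; apply: i_succ_le; rewrite i0 lt_neqAle eq_sym; apply/andP; split; [apply/eqP|].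
by have := i_ge0 a; nra.
Qed.

Lemma npair_ge a b : i a <= i ⟨a, b⟩ /\ i b <= i ⟨a, b⟩.
Proof.
have := i_sqr (a + b); rewrite /npair !iE.
by have [a0 b0] := (i_ge0 a, i_ge0 b); split; lra.
Qed.

Lemma lt_npair1 (a b : nn) : a ≺ ⟨a, b⟩ + 1.
Proof. by apply/i_leS; case: (npair_ge a b). Qed.

Lemma lt_npair2 (a b : nn) : b ≺ ⟨a, b⟩ + 1.
Proof. by apply/i_leS; case: (npair_ge a b). Qed.

(** Two existential quantifiers merge without decoding pairs: the new witness is a common bound,
    below which both are bounded quantifiers. *)
Lemma isS1_ex P : isS1 (fun e => P (behead e) (hd e)) -> isS1 (fun e => exists y, P e y).
Proof.
move=> [Q hQ QE].
pose R e y z := Q (z :: y :: e).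
apply: (@isS1_ext (fun e => exists w, exists y, y ≺ w /\ exists z, z ≺ w /\ R e y z)).
  move=> e; split=> [[w [y [_ [z [_ h]]]]]|[y /(QE (y :: e)) [z h]]].
    by exists y; apply/(QE (y :: e)); exists z.
  exists (y + z + 1); exists y; split; last exists z; last split=> //.
    by apply/i_lt; rewrite !iE; have := i_ge0 z; lra.
  by apply/i_lt; rewrite !iE; have := i_ge0 y; lra.
apply: isS1_exD0; cbv beta; apply: isD0_exists; first by T_tac.
cbv beta; apply: isD0_exists; first by T_tac.
rewrite /R; apply: isD0_sub hQ _; do 2 (apply: isSub_cons; first by T_tac).
by apply: isSub_tail; tail_tac.
Qed.

Lemma isS1_and P Q : isS1 P -> isS1 Q -> isS1 (fun e => P e /\ Q e).
Proof.
move=> [P' hP PE] [Q' hQ QE].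
apply: (@isS1_ext (fun e => exists y z, P' (y :: e) /\ Q' (z :: e))).
  by move=> e; rewrite PE QE; split=> [[y [z []]]|[[y ?] [z ?]]];
    [split; [exists y|exists z]|exists y, z].
apply: isS1_ex; apply: isS1_exD0; apply: isD0_and.
  apply: isD0_sub hP _; apply: isSub_cons; first by T_tac.
  by apply: isSub_tail; tail_tac.
apply: isD0_sub hQ _; apply: isSub_cons; first by T_tac.
by apply: isSub_tail; tail_tac.
Qed.

Lemma isS1_or P Q : isS1 P -> isS1 Q -> isS1 (fun e => P e \/ Q e).
Proof.
move=> [P' hP PE] [Q' hQ QE].
exists (fun e => P' e \/ Q' e); first exact: isD0_or.
by move=> e; rewrite PE QE; split=> [[[y ?]|[y ?]]|[y [?|?]]];
  [exists y; left|exists y; right|left; exists y|right; exists y].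
Qed.

(** From a counterexample x one descends: Sigma-1 induction on z yields a counterexample y with y +
    z = x, and z = x leaves only y = 0. The disjunct x < z covers the values past x. *)
Lemma Pi1_induction (P : nn -> Prop) : isS1 (fun e => ~ P (hd e)) ->
  P 0 -> (forall x, P x -> P (x + 1)) -> forall x, P x.
Proof.
move=> nP P0 PS x; apply: contrapT => nPx.
have h : forall z, exists y, ~ P y /\ (y + z = x \/ x ≺ z).
  apply: nn_ind => [||z [y [nPy h]]].
  - apply: isS1_ex; apply: isS1_and; last by apply: isS1_D0; D_tac.
    move: nP => [Q hQ QE]; exists (fun e => Q (hd e :: [:: hd (behead e)])).
      apply: isD0_sub hQ _; do 2 (apply: isSub_cons; first by T_tac).
      by move=> j; rewrite (_ : (fun e => _) = fun=> o); [exact: isT_const|apply/funext => e; rewrite nth_nil].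
    by move=> e; rewrite (QE [:: hd e]).
  - by exists x; split=> //; left; rewrite addr0.
  - case: h => [h|h]; last first.
      by exists y; split=> //; right; apply/ltS; left.
    have [y' e] : exists y', y = y' + 1 by apply: nn_pred => y0; move: nPy; rewrite y0.
    exists y'; split; first by move=> /PS; rewrite -e.
    by left; rewrite -h e; ring.
have [y [nPy [e|/i_lt]]] := h x; last by rewrite ltxx.
by apply: nPy; rewrite (@nn_addI y 0 x) // add0r.
Qed.

(** * Coding finite sets by divisibility *)

Ltac D_tac ::= cbv beta; first
  [ apply: isD0_not; D_tac | apply: isD0_and; D_tac | apply: isD0_or; D_tac
  | apply: isD0_forall; [T_tac|D_tac] | apply: isD0_exists; [T_tac|D_tac]
  | apply: isD0_imp; D_tac | apply: isD0_eq; T_tac | apply: isD0_lt; T_tac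
  | apply: isD0_mem; T_tac | exact: isD0_False
  | match goal with h : isD0 (fun e => ?P (hd e)) |- _ => apply: (isD0_app h); T_tac end ].
Ltac S_tac := cbv beta; first
  [ (apply: isS1_D0; D_tac) | (apply: isS1_ex; S_tac) | (apply: isS1_and; S_tac)
  | (apply: isS1_or; S_tac) ].

(* A finite set below [B] is coded by [c] when [y] belongs to it iff
   [1 + (y + 1) d] divides [c]; when [d] is a common multiple of [1 .. B], these
   divisors are pairwise coprime, so that elements can be added one by one. *)
Definition coded (d c y : nn) : Prop :=
  exists g, g ≺ c + 1 /\ (1 + (y + 1) * d) * g = c.

(** A divisor is at least 1, so the quotient never exceeds c; the bound in [coded] serves to keep it
    Delta-0. *)
Lemma codedP d c y : coded d c y <-> exists g, (1 + (y + 1) * d) * g = c.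
Proof.
split=> [[g [_ e]]|[g e]]; first by exists g.
exists g; split=> //; apply/i_leS; rewrite -e !iE.
by have := i_ge0 g; have := mulr_ge0 (mulr_ge0 (i_ge0 y) (i_ge0 d)) (i_ge0 g);
  have := mulr_ge0 (i_ge0 d) (i_ge0 g); nra.
Qed.

(** Replaces the factorial, which is not in the language: the induction step multiplies d by B +
    1. *)
Lemma common_multiple B : exists d, d <> 0 /\
  forall y, y ≺ B -> exists f, f ≺ d + 1 /\ (y + 1) * f = d.
Proof.
move: B; apply: nn_ind => [||B [d [d0 h]]]; first by S_tac.
  by exists 1; split=> [|y /lt0 //]; apply/eqP/oner_neq0.
exists (d * (B + 1)); split.
  by rewrite -(mul0r (B + 1)) => /nn_mulI.
have bound y f : (y + 1) * f = d * (B + 1) -> f ≺ d * (B + 1) + 1.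
  move=> e; apply/i_leS; rewrite -e !iE.
  by have := mulr_ge0 (i_ge0 y) (i_ge0 f); nra.
move=> y /ltS [/h [f [_ e]]|->].
  have e' : (y + 1) * (f * (B + 1)) = d * (B + 1) by rewrite mulrA e.
  by exists (f * (B + 1)); split=> //; apply: bound e'.
have e' : (B + 1) * d = d * (B + 1) by rewrite mulrC.
by exists d; split=> //; apply: bound e'.
Qed.

(** Let U = 1 + (y+1) d and V = 1 + (x+1) d. Then (x+1) U - (y+1) V = x - y, and d = (x-y) f for
    some f when x > y. Inserting this in c = U c - (y+1) d c and using U w = V c exhibits U as a
    factor of c. The case x < y is alike. *)
Lemma coprime_step B d x y w c : d <> 0 ->
  (forall y, y ≺ B -> exists f, f ≺ d + 1 /\ (y + 1) * f = d) ->
  x ≺ B -> y ≺ B -> x <> y ->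
  (1 + (y + 1) * d) * w = c * (1 + (x + 1) * d) -> exists g, (1 + (y + 1) * d) * g = c.
Proof.
move=> d0 hd xB yB xy.
have [U UE] : exists U, U = 1 + (y + 1) * d by eexists.
rewrite -UE => h.
have Upos : 0 < i U.
  by rewrite UE !iE; have := mulr_ge0 (i_ge0 y) (i_ge0 d); have := i_ge0 d; nra.
(* The cofactor involves a subtraction, which is performed in [K]; it is nonnegative because U is
   positive, and so comes from a number. *)
have fin m n : i U * (i m - i n) = i c -> exists g, U * g = c.
  move=> e; have [|g ge] := @i_sub m n.
    have : 0 <= i U * (i m - i n) by rewrite e.
    by rewrite pmulr_rge0 // subr_ge0.
  by exists g; apply: i_inj; rewrite iM ge.
have /(congr1 i) hK := h; rewrite !iE in hK.
have UK : i U = 1 + (i y + 1) * i d by rewrite UE !iE.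
have [k [e|e]] := nn_total y x.
- have [k' ke] : exists k', k = k' + 1.
    by apply: nn_pred => k0; apply: xy; rewrite -e k0 addr0.
  have [|f [_ fE]] := hd k'.
    move/i_lt: xB => xB; apply/i_lt; move: xB; rewrite -e ke !iE.
    by have := i_ge0 y; lra.
  have fK : (i x - i y) * i f = i d by rewrite -e -fE ke !iE; ring.
  apply: (fin (c + (y + 1) * (y + 1) * f * w) ((y + 1) * f * (x + 1) * c)).
  rewrite !iE.
  have -> : i U * (i c + (i y + 1) * (i y + 1) * i f * i w - (i y + 1) * i f * (i x + 1) * i c)
    = i U * i c + (i y + 1) * i f * ((i y + 1) * (i U * i w) - (i x + 1) * (i U * i c)) by ring.
  by rewrite hK UK -fK; ring.
- have [k' ke] : exists k', k = k' + 1.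
    by apply: nn_pred => k0; apply: xy; rewrite -e k0 addr0.
  have [|f [_ fE]] := hd k'.
    move/i_lt: yB => yB; apply/i_lt; move: yB; rewrite -e ke !iE.
    by have := i_ge0 x; lra.
  have fK : (i y - i x) * i f = i d by rewrite -e -fE ke !iE; ring.
  apply: (fin (c + (y + 1) * f * (x + 1) * c) ((y + 1) * (y + 1) * f * w)).
  rewrite !iE.
  have -> : i U * (i c + (i y + 1) * i f * (i x + 1) * i c - (i y + 1) * (i y + 1) * i f * i w)
    = i U * i c - (i y + 1) * i f * ((i y + 1) * (i U * i w) - (i x + 1) * (i U * i c)) by ring.
  by rewrite hK UK -fK; ring.
Qed.

(** The code is the product of 1 + (y+1) d over the elements y below n, built by induction on n. By
    [coprime_step] the new factor brings in no element other than n. *)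
Lemma finite_comprehension (P : nn -> Prop) B : isD0 (fun e => P (hd e)) ->
  exists d c, forall y, y ≺ B -> (coded d c y <-> P y).
Proof.
move=> hP; have [d [d0 hd]] := common_multiple B; exists d.
suff /(_ B) [c hc] : forall n, exists c, forall y, y ≺ B ->
    (coded d c y -> y ≺ n /\ P y) /\ (y ≺ n /\ P y -> coded d c y).
  exists c => y yB; have [h h'] := hc y yB.
  by split=> [/h []//|Py]; apply: h'.
apply: nn_ind => [||n [c h]]; first by rewrite /coded; S_tac.
  (* The empty product: no divisor divides 1, since d is not zero and each divisor exceeds 1. *)
  exists 1 => y _; split=> [|[/lt0]] // /codedP [g /(congr1 i)]; rewrite !iE => e.
  have [d' de] := nn_pred d0.
  rewrite de !iE in e.
  have g0 : i g <> 0 by move=> g0; move: e; rewrite g0 mulr0; lra.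
  have g1 : 1 <= i g.
    have [g' ->] : exists g', g = g' + 1 by apply: nn_pred => g0'; apply: g0; rewrite g0'.
    by rewrite !iE; have := i_ge0 g'; lra.
  have := mulr_ge0 (i_ge0 y) (i_ge0 d'); have := i_ge0 y; have := i_ge0 d'.
  by clear de d0; move=> *; exfalso; nra.
case: (EM (n ≺ B /\ P n)) => [[nB Pn]|nPn]; last first.
  exists c => y yB; have [h1 h2] := h y yB; split=> [/h1 [? ?]|[/ltS [yn|e] Py]].
  - by split=> //; apply/ltS; left.
  - exact: h2.
  - by case: nPn; rewrite -e.
exists (c * (1 + (n + 1) * d)) => y yB; have [h1 h2] := h y yB; split.
  case: (EM (y = n)) => [-> _|yn /codedP [w e]].
    by split=> //; apply/ltS; right.
  have /codedP/h1 [? ?] : exists g, (1 + (y + 1) * d) * g = c.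
    by apply: coprime_step d0 hd nB yB _ e => e'; apply: yn.
  by split=> //; apply/ltS; left.
move=> [/ltS [yn|->] Py]; apply/codedP; last by exists c; rewrite mulrC.
have /codedP [g e] : coded d c y by apply: h2.
by exists (g * (1 + (n + 1) * d)); rewrite mulrA e.
Qed.

(** * Interpretation of the definitions *)

(* A definition prefixed with [n] is the interpretation in [M] of its namesake in
   [Defs], with the connectives of the ambient logic. *)
Definition ncls : Type := nn -> Prop.
Definition nNum : ncls := fun x => x = x.
Definition nEl (A : numset M) : ncls := fun x => x ∈ A.
Definition nProd (C D : ncls) : ncls :=
  fun z => exists x y, z = ⟨x, y⟩ /\ C x /\ D y.

Definition nis_fun (F : numset M) (C D : ncls) : Prop :=
  (forall z, z ∈ F -> nProd C D z)
  /\ (forall x, C x -> exists y, ⟨x, y⟩ ∈ F)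
  /\ (forall x y y', ⟨x, y⟩ ∈ F /\ ⟨x, y'⟩ ∈ F -> y = y').

Record nrat : Type := NRat { qp : nn; qn : nn; qd : nn }.

Definition ncode (q : nrat) : nn := ⟨⟨qp q, qn q⟩, qd q⟩.

Definition nrat_lt (q r : nrat) : Prop :=
  qp q * (qd r + 1) + qn r * (qd q + 1) ≺ qp r * (qd q + 1) + qn q * (qd r + 1).
Definition nrat_le (q r : nrat) : Prop := ~ nrat_lt r q.
Definition nrat_pos (q : nrat) : Prop := qn q ≺ qp q.
Definition nrat_add (q r : nrat) : nrat :=
  NRat (qp q * (qd r + 1) + qp r * (qd q + 1))
       (qn q * (qd r + 1) + qn r * (qd q + 1))
       (qd q * qd r + qd q + qd r).

Definition nQQ : ncls := fun x => exists m n p, x = ncode (NRat m n p).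
Definition nQQpos : ncls :=
  fun x => exists m n p, x = ncode (NRat m n p) /\ nrat_pos (NRat m n p).

Definition nis_pow2 (k e : nn) : Prop :=
  exists F, nis_fun F nNum nNum
            /\ ⟨0, 1⟩ ∈ F
            /\ (forall i j, ⟨i, j⟩ ∈ F -> ⟨i + 1, j + j⟩ ∈ F)
            /\ ⟨k, e⟩ ∈ F.

Definition nat_pow (k : nn) (P : nrat -> Prop) : Prop :=
  exists p, nis_pow2 k (p + 1) /\ P (NRat 1 0 p).

Definition nreal : Type := nn -> nrat -> Prop.
Definition nreal_of_set (X : numset M) : nreal := fun k q => ⟨k, ncode q⟩ ∈ X.
Definition nreal_of_rat (r : nrat) : nreal := fun _ q => ncode q = ncode r.

Definition nis_cauchy (x : nreal) : Prop :=
  forall k i m n p m' n' p', x k (NRat m n p) /\ x (k + i) (NRat m' n' p') ->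
    nat_pow k (fun e => nrat_le (NRat m n p) (nrat_add (NRat m' n' p') e)
                     /\ nrat_le (NRat m' n' p') (nrat_add (NRat m n p) e)).

Definition nis_real (X : numset M) : Prop :=
  nis_fun X nNum nQQ /\ nis_cauchy (nreal_of_set X).

Definition nreal_le (x y : nreal) : Prop :=
  forall k m n p m' n' p', x k (NRat m n p) /\ y k (NRat m' n' p') ->
    nat_pow k (fun e => nrat_le (NRat m n p) (nrat_add (NRat m' n' p') (nrat_add e e))).
Definition nreal_lt (x y : nreal) : Prop := ~ nreal_le y x.
Definition nreal_eq (x y : nreal) : Prop := nreal_le x y /\ nreal_le y x.

Definition nreal_add (x y : nreal) : nreal := fun k q =>
  exists m n p m' n' p', x (k + 1) (NRat m n p) /\ y (k + 1) (NRat m' n' p')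
    /\ ncode q = ncode (nrat_add (NRat m n p) (NRat m' n' p')).

Definition nrat0 : nrat := NRat 0 0 0.

Definition ndist (D : numset M) (a b : nn) : nreal :=
  fun k q => ⟨⟨⟨a, b⟩, k⟩, ncode q⟩ ∈ D.

Definition nis_space (A D : numset M) : Prop :=
  nis_fun D (nProd (nProd (nEl A) (nEl A)) nNum) nQQ
  /\ (forall a b, a ∈ A /\ b ∈ A -> nis_cauchy (ndist D a b))
  /\ (forall a, a ∈ A -> nreal_eq (ndist D a a) (nreal_of_rat nrat0))
  /\ (forall a b, a ∈ A /\ b ∈ A ->
        nreal_eq (ndist D a b) (ndist D b a)
        /\ nreal_le (nreal_of_rat nrat0) (ndist D a b))
  /\ (forall a b c, a ∈ A /\ b ∈ A /\ c ∈ A ->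
        nreal_le (ndist D a b) (nreal_add (ndist D a c) (ndist D c b))).

Definition nis_point (A D X : numset M) : Prop :=
  nis_fun X nNum (nEl A)
  /\ (forall n a b, ⟨n, a⟩ ∈ X /\ ⟨n + 1, b⟩ ∈ X ->
        nat_pow n (fun e => nreal_lt (ndist D a b) (nreal_of_rat e))).

Definition npt : Type := nn -> nn -> Prop.
Definition npt_of_set (X : numset M) : npt := fun n a => ⟨n, a⟩ ∈ X.
Definition npt_of_elt (b : nn) : npt := fun _ a => a = b.

Definition npdist (D : numset M) (x y : npt) : nreal := fun k q =>
  exists a b, x (k + (1 + 1 + 1)) a /\ y (k + (1 + 1 + 1)) b
              /\ ndist D a b (k + (1 + 1 + 1)) q.

Definition nis_open_seq (A U : numset M) : Prop :=
  nis_fun U (nProd nNum nNum) (nProd (nEl A) nQQpos).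

Definition nin_open (D X U : numset M) (n : nn) : Prop :=
  exists m a m' n' p', ⟨⟨n, m⟩, ⟨a, ncode (NRat m' n' p')⟩⟩ ∈ U
    /\ nreal_lt (npdist D (npt_of_elt a) (npt_of_set X)) (nreal_of_rat (NRat m' n' p')).

Definition nis_open_covering (A D U : numset M) : Prop :=
  nis_open_seq A U /\ (forall X, nis_point A D X -> exists n, nin_open D X U n).

Definition nheine_borel (A D : numset M) : Prop :=
  forall U, nis_open_covering A D U ->
    exists B, forall X, nis_point A D X -> exists n, n ≺ B /\ nin_open D X U n.

Definition nrel (Phi : numset M) (a : nn) (r : nrat) (b : nn) (s : nrat) : Prop :=
  exists n, ⟨n, ⟨a, ⟨ncode r, ⟨b, ncode s⟩⟩⟩⟩ ∈ Phi.

Definition nis_continuous (A D B E Phi : numset M) : Prop :=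
  (forall z, z ∈ Phi ->
     nProd nNum (nProd (nEl A) (nProd nQQpos (nProd (nEl B) nQQpos))) z)
  /\ (forall a b b' m n p m1 n1 p1 m2 n2 p2,
        nrel Phi a (NRat m n p) b (NRat m1 n1 p1)
        /\ nrel Phi a (NRat m n p) b' (NRat m2 n2 p2) ->
        nreal_lt (ndist E b b') (nreal_of_rat (nrat_add (NRat m1 n1 p1) (NRat m2 n2 p2))))
  /\ (forall a b b' m n p m1 n1 p1 m2 n2 p2, b' ∈ B /\ nrat_pos (NRat m2 n2 p2) ->
        nrel Phi a (NRat m n p) b (NRat m1 n1 p1)
        /\ nreal_le (nreal_add (ndist E b b') (nreal_of_rat (NRat m1 n1 p1)))
                    (nreal_of_rat (NRat m2 n2 p2)) ->
        nrel Phi a (NRat m n p) b' (NRat m2 n2 p2))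
  /\ (forall a a' b m n p m1 n1 p1 m2 n2 p2, a' ∈ A /\ nrat_pos (NRat m1 n1 p1) ->
        nrel Phi a (NRat m n p) b (NRat m2 n2 p2)
        /\ nreal_le (nreal_add (ndist D a a') (nreal_of_rat (NRat m1 n1 p1)))
                    (nreal_of_rat (NRat m n p)) ->
        nrel Phi a' (NRat m1 n1 p1) b (NRat m2 n2 p2))
  /\ (forall X, nis_point A D X -> forall m n p, nrat_pos (NRat m n p) ->
        exists a b m1 n1 p1 m2 n2 p2, nrel Phi a (NRat m1 n1 p1) b (NRat m2 n2 p2)
          /\ nreal_lt (npdist D (npt_of_set X) (npt_of_elt a))
                      (nreal_of_rat (NRat m1 n1 p1))
          /\ nrat_lt (NRat m2 n2 p2) (NRat m n p)).

Definition nis_value (D B E Phi X Y : numset M) : Prop :=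
  nis_point B E Y
  /\ (forall a b m n p m1 n1 p1,
        nrel Phi a (NRat m n p) b (NRat m1 n1 p1)
        /\ nreal_lt (npdist D (npt_of_set X) (npt_of_elt a)) (nreal_of_rat (NRat m n p)) ->
        nreal_lt (npdist E (npt_of_set Y) (npt_of_elt b)) (nreal_of_rat (NRat m1 n1 p1))).

Definition nis_pos_real (X : numset M) : Prop :=
  nis_real X /\ nreal_lt (nreal_of_rat nrat0) (nreal_of_set X).

Definition nis_unif_continuous (A D B E Phi : numset M) : Prop :=
  forall eps, nis_pos_real eps ->
    exists del, nis_pos_real del /\
      forall X Y, nis_point A D X /\ nis_point A D Y ->
        nreal_lt (npdist D (npt_of_set X) (npt_of_set Y)) (nreal_of_set del) ->
        forall V W, nis_value D B E Phi X V /\ nis_value D B E Phi Y W ->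
          nreal_lt (npdist E (npt_of_set V) (npt_of_set W)) (nreal_of_set eps).

Definition natsuji (A D : numset M) : Prop :=
  forall B E Phi, nis_space B E /\ nis_continuous A D B E Phi ->
    nis_unif_continuous A D B E Phi.

(** * Values of the rationals of the model *)

Definition val (q : nrat) : K := (i (qp q) - i (qn q)) / (i (qd q) + 1).

Lemma i_den a : 0 < i a + 1.
Proof. by have := i_ge0 a; lra. Qed.

Lemma val_lt q r : nrat_lt q r <-> val q < val r.
Proof.
rewrite /nrat_lt /val i_lt !iE ltr_pdivrMr ?i_den // mulrAC ltr_pdivlMr ?i_den //.
by split=> h; lra.
Qed.

Lemma val_le q r : nrat_le q r <-> val q <= val r.
Proof. by rewrite /nrat_le val_lt leNgt; split=> /negP. Qed.

Lemma val_add q r : val (nrat_add q r) = val q + val r.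
Proof.
rewrite /val /= !iE; have := i_den (qd q); have := i_den (qd r).
move: (i (qd q)) (i (qd r)) => a b hb ha.
have -> : a * b + a + b + 1 = (a + 1) * (b + 1) by ring.
by field; rewrite !gt_eqF.
Qed.

Lemma val_pos q : nrat_pos q <-> 0 < val q.
Proof. by rewrite /nrat_pos i_lt /val pmulr_lgt0 ?subr_gt0 // invr_gt0 i_den. Qed.

Lemma val_rat0 : val nrat0 = 0.
Proof. by rewrite /val /= !iE subrr mul0r. Qed.

Lemma val_inv p : val (NRat 1 0 p) = (i p + 1)^-1.
Proof. by rewrite /val /= !iE subr0 mul1r. Qed.

Lemma ncode_inj q r : ncode q = ncode r -> q = r.
Proof.
by case: q r => [m n p] [m' n' p'] /npair_inj /= [/npair_inj [-> ->] ->].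
Qed.

Lemma lt_npair a b B : ⟨a, b⟩ ≺ B -> a ≺ B /\ b ≺ B.
Proof.
have [h1 h2] := npair_ge a b.
by move/i_lt => l; split; apply/i_lt; [exact: le_lt_trans h1 l|exact: le_lt_trans h2 l].
Qed.

(** * Powers of two *)

Definition incode (B d c y : nn) : Prop := y ≺ B /\ coded d c y.

(* A finite set of pairs witnessing [2 ^ k = j]. *)
Definition pow_witness (B d c k j : nn) : Prop :=
  incode B d c ⟨k, j⟩ /\
  forall a, a ≺ B -> forall v, v ≺ B -> incode B d c ⟨a, v⟩ ->
    (a = 0 /\ v = 1) \/
    exists a', a' ≺ B /\ exists v', v' ≺ B /\
      (a = a' + 1 /\ v = v' + v' /\ incode B d c ⟨a', v'⟩).

Lemma succ_neq0' (a : nn) : a + 1 <> 0. Proof. exact: succ_neq0. Qed.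

(** The clauses of a witness run backwards, from an exponent to its predecessor, so by induction two
    witnesses agree at every exponent that occurs in both. *)
Lemma pow_witness_uniq B d c B' d' c' k j j' :
  pow_witness B d c k j -> pow_witness B' d' c' k j' -> j = j'.
Proof.
move=> [kj h] [kj' h'].
suff : forall a v, v ≺ B -> forall v', v' ≺ B' -> incode B d c ⟨a, v⟩ ->
    incode B' d' c' ⟨a, v'⟩ -> v = v'.
  by apply; try eassumption; [case: kj => /lt_npair []|case: kj' => /lt_npair []].
apply: nn_ind => [||a IH v _ v' _ av av'].
- by rewrite /incode /coded; S_tac.
- move=> v _ v' _ av av'.
  have [a0 v0] := lt_npair (proj1 av); have [a0' v0'] := lt_npair (proj1 av').
  case: (h 0 a0 v v0 av) => [[_ ->]|[a' [_ [w [_ [e _]]]]]]; last first.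
    by have := @succ_neq0' a'; rewrite -e.
  case: (h' 0 a0' v' v0' av') => [[_ ->]//|[a' [_ [w [_ [e _]]]]]].
  by have := @succ_neq0' a'; rewrite -e.
- have [a0 v0] := lt_npair (proj1 av); have [a0' v0'] := lt_npair (proj1 av').
  case: (h _ a0 v v0 av) => [[/succ_neq0' []]|[b [_ [w [wB [e [-> bw]]]]]]].
  case: (h' _ a0' v' v0' av') => [[/succ_neq0' []]|[b' [_ [w' [wB' [e' [-> bw']]]]]]].
  have eb : a = b := nn_addI e; have eb' : a = b' := nn_addI e'; subst b b'.
  by rewrite (IH w wB w' wB').
Qed.

Definition is_pow (k j : nn) : Prop := exists B d c, pow_witness B d c k j.

Lemma is_pow0 : is_pow 0 1.
Proof.
have [|d [c h]] := @finite_comprehension (fun y => y = ⟨0, 1⟩) (⟨0, 1⟩ + 1).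
  by D_tac.
exists (⟨0, 1⟩ + 1), d, c; split.
  by split; [apply/ltS; right|apply/h => //; apply/ltS; right].
move=> a _ v _ [av /(h _ av)/npair_inj]; by left.
Qed.

(** Enlarging the bound changes the required common multiple, so the old set and the new pair are
    coded afresh. *)
Lemma is_powS k j : is_pow k j -> is_pow (k + 1) (j + j).
Proof.
move=> [B [d [c [kj hw]]]].
have [x xE] : exists x, x = ⟨k + 1, j + j⟩ by eexists.
pose B' := B + x + 1.
have [|d' [c' h]] := @finite_comprehension (fun y => incode B d c y \/ y = x) B'.
  by rewrite /incode /coded; D_tac.
have BB' y : y ≺ B -> y ≺ B'.
  by move/i_lt => l; apply/i_lt; rewrite /B' !iE; have := i_ge0 x; lra.
have old y : incode B d c y -> incode B' d' c' y.
  by move=> hy; have yB := BB' _ (proj1 hy); split=> //; apply/h => //; left.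
have xB : x ≺ B' by apply/i_lt; rewrite /B' !iE; have := i_ge0 B; lra.
exists B', d', c'; split; first by rewrite -xE; split=> //; apply/h => //; right.
move=> a _ v _ [av] /(h _ av) [av0|]; last (rewrite xE => /npair_inj [-> ->]).
- have [aB vB] := lt_npair (proj1 av0).
  case: (hw a aB v vB av0) => [|[a' [a'B [v' [v'B [e [e' o']]]]]]]; first by left.
  right; exists a'; split; first exact: BB'.
  by exists v'; split; [exact: BB'|split=> //; split=> //; exact: old].
- have [kB jB] := lt_npair (proj1 kj).
  right; exists k; split; first exact: BB'.
  by exists j; split; [exact: BB'|split=> //; split=> //; exact: old].
Qed.

Lemma is_pow_ex k : exists j, is_pow k j.
Proof.
move: k; apply: nn_ind => [||k [j h]].
- by rewrite /is_pow /pow_witness /incode /coded; S_tac.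
- by exists 1; apply: is_pow0.
- by exists (j + j); apply: is_powS.
Qed.

Lemma is_pow_uniq k j j' : is_pow k j -> is_pow k j' -> j = j'.
Proof. by move=> [B [d [c h]]] [B' [d' [c' h']]]; apply: pow_witness_uniq h h'. Qed.

(** The graph is Delta-1: a number is outside it iff it is not a pair, or it is a pair (k, j) for
    which some other j' is the power of exponent k. *)
Lemma pow_set : exists F, nis_fun F nNum nNum /\ ⟨0, 1⟩ ∈ F
  /\ (forall i j, ⟨i, j⟩ ∈ F -> ⟨i + 1, j + j⟩ ∈ F).
Proof.
have [|| F hF] := @D1_comprehension (fun z => exists k, k ≺ z + 1 /\
    exists j, j ≺ z + 1 /\ (z = ⟨k, j⟩ /\ is_pow k j)).
- by rewrite /is_pow /pow_witness /incode /coded; S_tac.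
- apply: (@isS1_ext (fun e =>
    (~ exists k, k ≺ hd e + 1 /\ exists j, j ≺ hd e + 1 /\ hd e = ⟨k, j⟩) \/
    exists k j, hd e = ⟨k, j⟩ /\ exists j', j' <> j /\ is_pow k j')).
    move=> e; split.
      move=> [h [k [kz [j [jz [e' _]]]]]|[k [j [e' [j' [nj p]]]]] [k1 [_ [j1 [_ [e1 p1]]]]]].
        by apply: h; exists k; split=> //; exists j.
      move: e1; rewrite e' => /npair_inj [e2 e3]; apply: nj; subst k1 j1.
      exact: is_pow_uniq p p1.
    move=> h; case: (EM (exists k, k ≺ hd e + 1 /\ exists j, j ≺ hd e + 1 /\ hd e = ⟨k, j⟩));
      last by left.
    move=> [k [kz [j [jz e']]]]; right; exists k, j; split=> //.
    have [j' pj'] := is_pow_ex k; exists j'; split=> // e1; apply: h.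
    by exists k; split=> //; exists j; split=> //; split=> //; rewrite -e1.
  by rewrite /is_pow /pow_witness /incode /coded; S_tac.
have FE k j : ⟨k, j⟩ ∈ F <-> is_pow k j.
  rewrite hF; split=> [[k1 [_ [j1 [_ [/npair_inj [-> ->]]]]]] //|p].
  by exists k; split; [exact: lt_npair1|exists j; split=> //; exact: lt_npair2].
exists F; split; last by split=> [|k j]; rewrite !FE; [exact: is_pow0|exact: is_powS].
split; first by move=> z /hF [k [_ [j [_ [e _]]]]]; exists k, j.
split=> [k _|k j j']; first by have [j] := is_pow_ex k; exists j; apply/FE.
by move=> [/FE p /FE p']; apply: is_pow_uniq p p'.
Qed.

Section Powers.
Variable F : numset M.
Hypotheses (F_fun : nis_fun F nNum nNum) (F0 : ⟨0, 1⟩ ∈ F).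
Hypothesis FS : forall i j, ⟨i, j⟩ ∈ F -> ⟨i + 1, j + j⟩ ∈ F.

Definition pw (k : nn) : nn := projT1 (cid (proj1 (proj2 F_fun) k erefl)).

Lemma pwF k : ⟨k, pw k⟩ ∈ F.
Proof. by rewrite /pw; case: cid. Qed.

Lemma FE k e : ⟨k, e⟩ ∈ F <-> e = pw k.
Proof.
split=> [h|->]; last exact: pwF.
by apply: (proj2 (proj2 F_fun) k); split; [exact: h|exact: pwF].
Qed.

Lemma pwS k : pw (k + 1) = pw k + pw k. Proof. by apply/esym/FE/FS/pwF. Qed.

(** Two sets obeying the recursion share a value at every exponent, by induction, so the choice of
    set in [is_pow2] is immaterial. *)
Lemma nis_pow2E k e : nis_pow2 k e <-> e = pw k.
Proof.
split=> [[G [G_fun [G0 [GS ke]]]]|->]; last by exists F; do 3 split=> //; apply: pwF.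
have [v [/FE <- Gv]] : exists v, ⟨k, v⟩ ∈ F /\ ⟨k, v⟩ ∈ G.
  move: k {ke}; apply: nn_ind => [||k [v [Fv Gv]]].
  - by S_tac.
  - by exists 1.
  - by exists (v + v); split; [exact: FS|exact: GS].
exact: (proj2 (proj2 G_fun) k).
Qed.

(** [pw] is not a term of the language; the induction formula speaks of its graph [F] instead. *)
Lemma pw_gt k : i k + 1 <= i (pw k).
Proof.
have [e [/FE <- /i_lt/i_succ_le //]] : exists e, ⟨k, e⟩ ∈ F /\ k ≺ e.
move: k; apply: nn_ind => [||k [e [Fe /i_lt/i_succ_le l]]].
- by S_tac.
- by exists 1; split=> //; apply/i_lt; rewrite !iE ltr01.
- exists (e + e); split; first exact: FS.
  by apply/i_lt; rewrite !iE; have := i_ge0 k; lra.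
Qed.

Lemma pw_le k a : i (pw k) <= i (pw (k + a)).
Proof.
have [e [/FE -> /i_leS //]] : exists e, ⟨k + a, e⟩ ∈ F /\ pw k ≺ e + 1.
move: a; apply: nn_ind => [||a [e [Fe /i_leS l]]].
- by S_tac.
- by exists (pw k); split; [apply/FE; rewrite addr0|apply/i_leS].
- exists (e + e); split; first by rewrite addrA; apply: FS.
  by apply/i_leS; rewrite !iE; have := i_ge0 e; lra.
Qed.

Definition E (k : nn) : K := (i (pw k))^-1.

Lemma pw_pos k : 0 < i (pw k).
Proof. by have := pw_gt k; have := i_ge0 k; lra. Qed.
Lemma E_gt0 k : 0 < E k. Proof. by rewrite invr_gt0 pw_pos. Qed.
Lemma ES k : E (k + 1) = E k / 2.
Proof. by rewrite /E pwS iD (_ : _ + _ = i (pw k) * 2) ?invfM //; ring. Qed.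
Lemma E_le k a : E (k + a) <= E k.
Proof. by rewrite /E lef_pV2 ?posrE ?pw_pos // pw_le. Qed.

(** A positive x equals m/(p+1) with m at least 1, hence exceeds 1/(p+2). *)
Lemma inv_small x : 0 < x -> exists p, (i p + 1)^-1 < x.
Proof.
move=> x0; have [m [p xE]] := i_frac (ltW x0); exists (p + 1).
have m1 : 1 <= i m.
  have [m' ->] : exists m', m = m' + 1.
    by apply: nn_pred => m0; move: x0; rewrite xE m0 i0 mul0r ltxx.
  by rewrite !iE; have := i_ge0 m'; lra.
rewrite xE ltr_pdivlMr ?i_den // mulrC ltr_pdivrMr ?i_den // !iE.
by have := i_ge0 p; nra.
Qed.

Lemma E_small x : 0 < x -> exists k, forall j, E (k + j) < x.
Proof.
move=> /inv_small [p px]; exists p => j; apply: le_lt_trans (E_le _ _) _.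
by apply: le_lt_trans px; rewrite /E lef_pV2 ?posrE ?pw_pos ?i_den // pw_gt.
Qed.

Lemma nat_powE k (P : nrat -> Prop) (Q : Prop) :
  (forall e, val e = E k -> P e <-> Q) -> nat_pow k P <-> Q.
Proof.
have vE p : p + 1 = pw k -> val (NRat 1 0 p) = E k.
  by move=> e; rewrite val_inv /E -e iD i1.
move=> PQ; split=> [[p [/nis_pow2E /vE/PQ]]|q]; first by move=> h /h.
have [p e] : exists p, pw k = p + 1.
  by apply: nn_pred => p0; have := pw_pos k; rewrite p0 i0 ltxx.
by exists p; split; [apply/nis_pow2E|apply/PQ => //; apply: vE].
Qed.

(** * Reals, spaces and points of a model *)

(* [w k] is the value in [K] of the [k]-th approximation of [x]. *)
Definition nrepr (x : nreal) (w : nn -> K) : Prop :=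
  (forall k, exists q, x k q) /\ (forall k q, x k q -> val q = w k).

Lemma nrepr_real_le x y w z : nrepr x w -> nrepr y z ->
  nreal_le x y <-> forall k, w k <= z k + 2 * E k.
Proof.
move=> [xe xw] [ye yz]; split=> [h k|h k m n p m' n' p' [hx hy]].
  have [[m n p] hx] := xe k; have [[m' n' p'] hy] := ye k.
  have /nat_powE := h k m n p m' n' p' (conj hx hy); apply => e eE.
  by rewrite val_le !val_add (xw _ _ hx) (yz _ _ hy) eE -[E k + E k]mulr2n mulr_natl.
apply/nat_powE; last exact: (h k); move=> e eE.
by rewrite val_le !val_add (xw _ _ hx) (yz _ _ hy) eE -[E k + E k]mulr2n mulr_natl.
Qed.

Lemma nrepr_real_lt x y w z : nrepr x w -> nrepr y z ->
  nreal_lt x y <-> exists k, w k + 2 * E k < z k.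
Proof.
move=> hx hy; rewrite /nreal_lt (nrepr_real_le hy hx).
split=> [h|[k l] /(_ k)]; last by rewrite leNgt l.
apply: contrapT => n; apply: h => k; rewrite leNgt; apply/negP => l.
by apply: n; exists k.
Qed.

Lemma nrepr_cauchy x w : nrepr x w -> nis_cauchy x ->
  forall k a, w k <= w (k + a) + E k /\ w (k + a) <= w k + E k.
Proof.
move=> [xe xw] h k a; have [[m n p] hx] := xe k; have [[m' n' p'] hy] := xe (k + a).
have /nat_powE := h k a m n p m' n' p' (conj hx hy); apply => e eE.
by rewrite !val_le !val_add (xw _ _ hx) (xw _ _ hy) eE.
Qed.

Lemma nrepr_rat r : nrepr (nreal_of_rat r) (fun=> val r).
Proof. by split=> [k|k q /ncode_inj -> //]; exists r. Qed.

Lemma nrepr_add x y w z : nrepr x w -> nrepr y z ->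
  nrepr (nreal_add x y) (fun k => w (k + 1) + z (k + 1)).
Proof.
move=> [xe xw] [ye yz]; split=> [k|k q].
  have [[m n p] hx] := xe (k + 1); have [[m' n' p'] hy] := ye (k + 1).
  by exists (nrat_add (NRat m n p) (NRat m' n' p')), m, n, p, m', n', p'.
move=> [m [n [p [m' [n' [p' [hx [hy /ncode_inj ->]]]]]]]].
by rewrite val_add (xw _ _ hx) (yz _ _ hy).
Qed.

(** The values are picked by choice outside the model. Where an induction concerns them, the formula
    is translated back to sets of the model. *)
Lemma nrepr_ex (x : nreal) : (forall k, exists q, x k q) ->
  (forall k q q', x k q -> x k q' -> q = q') -> exists w, nrepr x w.
Proof.
move=> /choice [f hf] xu; exists (fun k => val (f k)).
split=> [k|k q hq]; first by exists (f k).
by rewrite (xu k q (f k)).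
Qed.

(* [d a b k] is the value of the [k]-th approximation of the distance. *)
Definition mspace (A D : numset M) (d : nn -> nn -> nn -> K) : Prop :=
  (forall a b, a ∈ A -> b ∈ A -> nrepr (ndist D a b) (d a b)) /\
  (forall a b k j, a ∈ A -> b ∈ A ->
     d a b k <= d a b (k + j) + E k /\ d a b (k + j) <= d a b k + E k) /\
  (forall a k, a ∈ A -> d a a k <= 2 * E k) /\
  (forall a b k, a ∈ A -> b ∈ A -> d a b k <= d b a k + 2 * E k) /\
  (forall a b k, a ∈ A -> b ∈ A -> 0 <= d a b k + 2 * E k) /\
  (forall a b c k, a ∈ A -> b ∈ A -> c ∈ A ->
     d a b k <= d a c (k + 1) + d c b (k + 1) + 2 * E k).

Lemma nis_space_mspace A D : nis_space A D -> exists d, mspace A D d.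
Proof.
move=> [[Dr [Dt Du]] [cau [refl [sym tri]]]].
have /choice [d hd] : forall ab : nn * nn, exists w,
    ab.1 ∈ A -> ab.2 ∈ A -> nrepr (ndist D ab.1 ab.2) w.
  move=> [a b] /=.
  case: (EM (a ∈ A /\ b ∈ A)) => [[aA bA]|n]; last first.
    by exists (fun=> 0) => aA bA; case: n.
  have [|k q q' h h'|w hw] := @nrepr_ex (ndist D a b); last by exists w.
    move=> k; have [|y hy] := Dt ⟨⟨a, b⟩, k⟩.
      by exists ⟨a, b⟩, k; split=> //; split=> //; exists a, b.
    have [x [y' [/npair_inj [_ <-] [_ [m [n [p e]]]]]]] := Dr _ hy.
    by exists (NRat m n p); rewrite /ndist -e.
  by apply/ncode_inj/(Du ⟨⟨a, b⟩, k⟩).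
exists (fun a b => d (a, b)).
have {}hd a b : a ∈ A -> b ∈ A -> nrepr (ndist D a b) (d (a, b)) := hd (a, b).
have r0 := nrepr_rat nrat0; rewrite val_rat0 in r0.
split=> //; split; last split; last split; last split.
- by move=> a b k j aA bA; apply: nrepr_cauchy (hd _ _ aA bA) (cau _ _ _) _ _.
- move=> a k aA; have [/(nrepr_real_le (hd _ _ aA aA) r0) h _] := refl a aA.
  by have := h k; rewrite add0r.
- move=> a b k aA bA; have [[h _] _] := sym a b (conj aA bA).
  by move/(nrepr_real_le (hd _ _ aA bA) (hd _ _ bA aA)): h.
- move=> a b k aA bA; have [_ h] := sym a b (conj aA bA).
  by move/(nrepr_real_le r0 (hd _ _ aA bA)): h.
- move=> a b c k aA bA cA; have h := tri a b c (conj aA (conj bA cA)).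
  by move/(nrepr_real_le (hd _ _ aA bA) (nrepr_add (hd _ _ aA cA) (hd _ _ cA bA))): h.
Qed.

Lemma nonpos_limit x C : 0 <= C -> (forall j, x <= C * E j) -> x <= 0.
Proof.
move=> C0 h; rewrite leNgt; apply/negP => x0.
have [|k /(_ 0)] := @E_small (x / (C + 1)); first by apply: divr_gt0; lra.
rewrite addr0 ltr_pdivlMr; last by lra.
by have := h k; have := E_gt0 k; nra.
Qed.

Section Space.
Variables (A D : numset M) (d : nn -> nn -> nn -> K).
Hypothesis AD : mspace A D d.

Let d_repr a b : a ∈ A -> b ∈ A -> nrepr (ndist D a b) (d a b).
Proof. by case: AD => h _; apply: h. Qed.
Let d_cauchy a b k j : a ∈ A -> b ∈ A ->
  d a b k <= d a b (k + j) + E k /\ d a b (k + j) <= d a b k + E k.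
Proof. by case: AD => _ [h _]; apply: h. Qed.
Let d_refl a k : a ∈ A -> d a a k <= 2 * E k.
Proof. by case: AD => _ [_ [h _]]; apply: h. Qed.
Let d_sym a b k : a ∈ A -> b ∈ A -> d a b k <= d b a k + 2 * E k.
Proof. by case: AD => _ [_ [_ [h _]]]; apply: h. Qed.
Let d_pos a b k : a ∈ A -> b ∈ A -> 0 <= d a b k + 2 * E k.
Proof. by case: AD => _ [_ [_ [_ [h _]]]]; apply: h. Qed.
Let d_tri a b c k : a ∈ A -> b ∈ A -> c ∈ A ->
  d a b k <= d a c (k + 1) + d c b (k + 1) + 2 * E k.
Proof. by case: AD => _ [_ [_ [_ [_ h]]]]; apply: h. Qed.

(* [d(a, b) <= t] *)
Definition dle (a b : nn) (t : K) : Prop := forall j, d a b j <= t + E j.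

(** Passing from index j to j + k costs at most 2^-j, while the error at j + k vanishes as k grows;
    hence the constant C improves to 1. *)
Lemma dle_limit a b t C : a ∈ A -> b ∈ A -> 0 <= C ->
  (forall j, d a b j <= t + C * E j) -> dle a b t.
Proof.
move=> aA bA C0 h j.
suff : d a b j - t - E j <= 0 by lra.
apply: (nonpos_limit C0) => k.
have [h1 _] := d_cauchy j k aA bA; have := h (j + k); have := E_le k j.
by rewrite [k + j]addrC; nra.
Qed.

Lemma dle_trans a b c s t : a ∈ A -> b ∈ A -> c ∈ A ->
  dle a c s -> dle c b t -> dle a b (s + t).
Proof.
move=> aA bA cA h h'; apply: (@dle_limit _ _ _ 3) => // j.
have := d_tri j aA bA cA; have := h (j + 1); have := h' (j + 1); rewrite ES.
by lra.
Qed.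

Lemma dle_sym a b t : a ∈ A -> b ∈ A -> dle a b t -> dle b a t.
Proof.
move=> aA bA h; apply: (@dle_limit _ _ _ 3) => // j.
by have := d_sym j bA aA; have := h j; lra.
Qed.

Lemma dle_refl a : a ∈ A -> dle a a 0.
Proof.
by move=> aA; apply: (@dle_limit _ _ _ 2) => // j; rewrite add0r; apply: d_refl.
Qed.

Lemma dle_ge0 a b t : a ∈ A -> b ∈ A -> dle a b t -> 0 <= t.
Proof.
move=> aA bA h; suff : - t <= 0 by lra.
apply: (@nonpos_limit _ 3) => // j.
by have := d_pos j aA bA; have := h j; lra.
Qed.

Lemma dle_le a b s t : s <= t -> dle a b s -> dle a b t.
Proof. by move=> st h j; have := h j; lra. Qed.

Lemma dle_lt a b e : a ∈ A -> b ∈ A -> nreal_lt (ndist D a b) (nreal_of_rat e) ->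
  dle a b (val e).
Proof.
move=> aA bA /(nrepr_real_lt (d_repr aA bA) (nrepr_rat e)) [k h] j.
have [h1 _] := d_cauchy j k aA bA; have [_ h2] := d_cauchy k j aA bA.
by move: h1 h2 (E_gt0 k); rewrite [k + j]addrC; lra.
Qed.

Lemma dle_approx a b n : a ∈ A -> b ∈ A -> dle a b (d a b n + E n).
Proof.
move=> aA bA j.
have [h1 _] := d_cauchy j n aA bA; have [_ h2] := d_cauchy n j aA bA.
by move: h1 h2; rewrite [n + j]addrC; lra.
Qed.

(** The bound 2 * 2^-n is the sum of the step bounds 2^-m over m >= n. *)
Definition point (P : npt) (x : nn -> nn) : Prop :=
  (forall n a, P n a <-> a = x n) /\ (forall n, x n ∈ A) /\
  (forall n j, dle (x n) (x (n + j)) (2 * E n)).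

Lemma point_elt a : a ∈ A -> point (npt_of_elt a) (fun=> a).
Proof.
move=> aA; split=> //; split=> // n j; apply: dle_le (dle_refl aA).
by have := E_gt0 n; lra.
Qed.

Lemma point_set X : nis_point A D X -> exists x, point (npt_of_set X) x.
Proof.
move=> [[Xr [Xt Xu]] Xc].
have /choice [x hx] : forall n, exists a, ⟨n, a⟩ ∈ X by move=> n; apply: Xt.
have xE n a : ⟨n, a⟩ ∈ X <-> a = x n.
  by split=> [h|-> //]; apply: (Xu n).
have xA n : x n ∈ A.
  by have [n' [a [/npair_inj [_ ->] [_]]]] := Xr _ (hx n).
exists x; split=> //; split=> // n j.
(* The partial geometric sum, in place of the full one, makes the claim inductive. *)
suff h : dle (x n) (x (n + j)) (2 * E n - 2 * E (n + j)).
  by apply: dle_le h; have := E_gt0 (n + j); lra.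
have valE p k : p + 1 = pw k -> val (NRat 1 0 p) = E k.
  by move=> e; rewrite val_inv /E -e iD i1.
have pw1 k : exists p, p + 1 = pw k.
  have [p e] : exists p, pw k = p + 1; last by exists p.
  by apply: nn_pred => p0; have := pw_pos k; rewrite p0 i0 ltxx.
have [pn en] := pw1 n.
move: j; apply: Pi1_induction => [||j h].
- pose twice p := nrat_add (NRat 1 0 p) (NRat 1 0 p).
  (* The negated bound as a Sigma-1 formula over [X], [D] and [F]: some J-th approximation exceeds
     it by more than 2^-J. The subtracted term is moved to the other side, and p2, p3 encode the
     powers of exponents n + j and J. *)
  apply: (@isS1_ext (fun e => exists J a m n' p p2 p3, ⟨n + hd e, a⟩ ∈ X /\
    (⟨⟨⟨x n, a⟩, J⟩, ncode (NRat m n' p)⟩ ∈ D /\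
    (⟨n + hd e, p2 + 1⟩ ∈ F /\ (⟨J, p3 + 1⟩ ∈ F /\
     nrat_lt (nrat_add (twice pn) (NRat 1 0 p3))
             (nrat_add (NRat m n' p) (twice p2))))))); last first.
    rewrite /twice /nrat_add /ncode /nrat_lt /=; S_tac.
  move=> e; have [_ dE] := d_repr (xA n) (xA (n + hd e)).
  split.
    move=> [J [a [m [n' [p [p2 [p3 [/xE -> [/dE dJ [/FE/valE h2 [/FE/valE h3]]]]]]]]]]].
    rewrite val_lt !val_add (valE _ _ en) h2 h3 dJ => l /(_ J).
    by lra.
  move=> h; have [J l] : exists J, d (x n) (x (n + hd e)) J > 2 * E n - 2 * E (n + hd e) + E J.
    apply: contrapT => nJ; apply: h => J; rewrite leNgt; apply/negP => l.
    by apply: nJ; exists J.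
  have [[m n' p] hJ] := proj1 (d_repr (xA n) (xA (n + hd e))) J.
  have [p2 e2] := pw1 (n + hd e); have [p3 e3] := pw1 J.
  exists J, (x (n + hd e)), m, n', p, p2, p3.
  do 2 (split=> //); split; first exact/FE; split; first exact/FE.
  rewrite val_lt !val_add (valE _ _ en) (valE _ _ e2) (valE _ _ e3) (dE _ _ hJ).
  by lra.
- by rewrite addr0 subrr; apply: dle_refl.
- have st : dle (x (n + j)) (x (n + j + 1)) (E (n + j)).
    have := Xc (n + j) _ _ (conj (hx _) (hx _)).
    move=> [p [/nis_pow2E/valE e /dle_lt]]; rewrite e; exact.
  rewrite addrA; have := dle_trans (xA _) (xA _) (xA _) h st.
  by apply: dle_le; rewrite ES; lra.
Qed.

(** Replaces the real [pdist] by a bound on late terms, for which triangle inequalities add up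
    without error terms. *)
Definition near (x y : nn -> nn) (t : K) : Prop :=
  exists k, forall m, dle (x (k + m)) (y (k + m)) t.

Lemma near_trans P Q R x y z s t : point P x -> point Q y -> point R z ->
  near x y s -> near y z t -> near x z (s + t).
Proof.
move=> [_ [xA _]] [_ [yA _]] [_ [zA _]] [k h] [k' h']; exists (k + k') => m.
have e := h (k' + m); have e' := h' (k + m); rewrite addrA in e.
by rewrite addrA [k' + k]addrC in e'; apply: dle_trans e e'.
Qed.

Lemma near_sym P Q x y t : point P x -> point Q y -> near x y t -> near y x t.
Proof.
by move=> [_ [xA _]] [_ [yA _]] [k h]; exists k => m; apply: dle_sym.
Qed.

Lemma near_ge0 P Q x y t : point P x -> point Q y -> near x y t -> 0 <= t.
Proof. by move=> [_ [xA _]] [_ [yA _]] [k /(_ 0)]; apply: dle_ge0. Qed.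

Let n3 : nn := 1 + 1 + 1.

Lemma nrepr_pdist P Q x y : point P x -> point Q y ->
  nrepr (npdist D P Q) (fun k => d (x (k + n3)) (y (k + n3)) (k + n3)).
Proof.
move=> [xE [xA _]] [yE [yA _]]; split=> [k|k q].
  have [q hq] := proj1 (d_repr (xA (k + n3)) (yA (k + n3))) (k + n3).
  by exists q, (x (k + n3)), (y (k + n3)); split; [apply/xE|split; [apply/yE|]].
move=> [a [b [/xE -> [/yE ->]]]].
exact: (proj2 (d_repr (xA (k + n3)) (yA (k + n3)))).
Qed.

Lemma near_real_lt P Q x y t z w c k0 : point P x -> point Q y -> nrepr z w ->
  (forall j, c <= w (k0 + j)) -> t < c -> near x y t -> nreal_lt (npdist D P Q) z.
Proof.
move=> hx hy hz wc tc [k1 h]; apply/(nrepr_real_lt (nrepr_pdist hx hy) hz).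
(* Three errors of size at most 2^-k occur, one from [dle] and two from the comparison of reals; a
   quarter of the gap covers them. *)
have [|k2 h2] := @E_small ((c - t) / 4); first by lra.
exists (k0 + k1 + k2).
have := h (k0 + k2 + n3) (k0 + k1 + k2 + n3).
have -> : k1 + (k0 + k2 + n3) = k0 + k1 + k2 + n3 by ring.
have := wc (k1 + k2); rewrite [k0 + (k1 + k2)]addrA.
have := E_le (k0 + k1 + k2) n3; have := h2 (k0 + k1); rewrite [k2 + _]addrC.
by lra.
Qed.

Lemma real_lt_near P Q x y z c : point P x -> point Q y -> nrepr z (fun=> c) ->
  nreal_lt (npdist D P Q) z <-> exists t, t < c /\ near x y t.
Proof.
move=> hx hy hz; split=> [|[t [tc h]]]; last first.
  by apply: (near_real_lt (k0 := 0) hx hy hz _ tc h) => j.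
move=> /(nrepr_real_lt (nrepr_pdist hx hy) hz) [k]; set n := k + n3 => h.
have En : E n = E k / 8.
  by rewrite /n /n3 !addrA !ES; field.
move: hx hy => [_ [xA xc]] [_ [yA yc]].
(* One 2^-n for the approximation and two for the tail of each point; as n = k + 3, the total 5/8 *
   2^-k fits into the slack 2 * 2^-k. *)
exists (d (x n) (y n) n + 5 * E n); split.
  by move: h; rewrite En; have := E_gt0 k; lra.
exists n => m; have h1 := dle_sym (xA _) (xA _) (xc n m).
have h2 := dle_trans (xA _) (yA _) (xA _) h1 (dle_approx n (xA n) (yA n)).
have h3 := dle_trans (xA _) (yA _) (yA _) h2 (yc n m).
by apply: dle_le h3; lra.
Qed.

End Space.

(** * The covering and the uniform modulus *)

(** Components of a pair do not exceed the pair, so quantifiers over the parts of a code are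
    implicitly bounded. [ex_tac] removes them with this lemma, the bounds being found along the
    nesting of pairs. *)
Lemma isD0_exists_le t P : isT t -> (forall e y, P e y -> y ≺ t e + 1) ->
  isD0 (fun e => P (behead e) (hd e)) -> isD0 (fun e => exists y, P e y).
Proof.
move=> ht bound hP; apply: isD0_ext (isD0_exists (isT_addr ht (isT_const 1)) hP) => e.
by split=> [[y [_ h]]|[y h]]; exists y => //; split=> //; apply: bound h.
Qed.

Ltac le_pair := match goal with
  | |- is_true (i ?x <= i ⟨?a, ?b⟩) =>
      first [ exact: lexx
            | apply: le_trans (proj1 (npair_ge a b)); le_pair
            | apply: le_trans (proj2 (npair_ge a b)); le_pair ]
  | |- _ => exact: lexx
  end.
Ltac bound_tac := intros; repeat match goal with
  | h : ex _ |- _ => destruct h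
  | h : _ /\ _ |- _ => destruct h
  end;
  match goal with
  | h : hd _ = _ |- _ => cbv beta; rewrite h; apply/i_leS; rewrite /ncode /=; le_pair
  end.
Ltac ex_tac k t := lazymatch k with
  | 0%N => idtac
  | S ?k => apply: (@isD0_exists_le t); [T_tac|bound_tac|cbv beta];
      let t' := eval cbv beta in (fun e => t (behead e)) in ex_tac k t'
  end.

Section Cover.
Variables (A D B G Phi : numset M) (d g : nn -> nn -> nn -> K) (q0 : nrat).
Hypotheses (AD : mspace A D d) (BG : mspace B G g).
Hypothesis Phi_cont : nis_continuous A D B G Phi.
Hypothesis q0_pos : nrat_pos q0.

Definition entry (c a : nn) (r : nrat) (b : nn) (s : nrat) : nn :=
  ⟨c, ⟨a, ⟨ncode r, ⟨b, ncode s⟩⟩⟩⟩.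

(* [r - 1 / (p + 1)] *)
Definition shrink (r : nrat) (p : nn) : nrat :=
  NRat (qp r * (p + 1)) (qn r * (p + 1) + (qd r + 1)) (qd r * p + qd r + p).

Lemma val_shrink r p : val (shrink r p) = val r - (i p + 1)^-1.
Proof.
rewrite /val /= !iE; have := i_den (qd r); have := i_den p.
move: (i (qd r)) (i p) => a b hb ha.
have -> : a * b + a + b + 1 = (a + 1) * (b + 1) by ring.
by field; rewrite !gt_eqF.
Qed.

(* The index [n] of a ball codes both the element of [Phi] that justifies it and
   the amount [1 / (p + 1)] by which its radius was shrunk; pairing gives
   [p <= n]. *)
Definition valid (n : nn) : Prop := exists c a m1 n1 d1 b m2 n2 d2 p,
  n = ⟨entry c a (NRat m1 n1 d1) b (NRat m2 n2 d2), p⟩ /\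
  (entry c a (NRat m1 n1 d1) b (NRat m2 n2 d2) ∈ Phi /\
  (nrat_lt (NRat m2 n2 d2) q0 /\ nrat_pos (shrink (NRat m1 n1 d1) p))).

Definition ball (n w : nn) : Prop := exists c a m1 n1 d1 b m2 n2 d2 p,
  n = ⟨entry c a (NRat m1 n1 d1) b (NRat m2 n2 d2), p⟩ /\
  (entry c a (NRat m1 n1 d1) b (NRat m2 n2 d2) ∈ Phi /\
  (nrat_lt (NRat m2 n2 d2) q0 /\ (nrat_pos (shrink (NRat m1 n1 d1) p) /\
   w = ⟨a, ncode (shrink (NRat m1 n1 d1) p)⟩))).

(** A variable is put in place of t; it then bounds the ten components of the code. *)
Lemma isD0_valid t : isT t -> isD0 (fun e => valid (t e)).
Proof.
move=> ht; rewrite (_ : (fun e => _) = fun e => valid (hd [:: t e])) //.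
apply: (isD0_sub (f := fun e => [:: t e]) (P := fun e => valid (hd e))); last first.
  apply: isSub_cons => // j; rewrite (_ : (fun e => _) = fun=> o); first exact: isT_const.
  by apply/funext => e; rewrite nth_nil.
rewrite /valid /entry.
ex_tac 10%N hd.
by rewrite /nrat_lt /nrat_pos /shrink /ncode /=; D_tac.
Qed.

Lemma isD0_ball_index t s : isT t -> isT s -> isD0 (fun e => ball (t e) (s e)).
Proof.
move=> ht hs; rewrite (_ : (fun e => _) =
  fun e => ball (hd [:: t e; s e]) (hd (behead [:: t e; s e]))) //.
apply: (isD0_sub (f := fun e => [:: t e; s e])
                 (P := fun e => ball (hd e) (hd (behead e)))); last first.
  do 2 (apply: isSub_cons => //).
  move=> j; rewrite (_ : (fun e => _) = fun=> o); first exact: isT_const.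
  by apply/funext => e; rewrite nth_nil.
rewrite /ball /entry.
ex_tac 10%N hd.
by rewrite /nrat_lt /nrat_pos /shrink /ncode /=; D_tac.
Qed.

Lemma nProdP (C C' : ncls) a b : nProd C C' ⟨a, b⟩ <-> C a /\ C' b.
Proof.
split=> [[x [y [/npair_inj [-> ->]]]] //|[Ca Cb]]; by exists a, b.
Qed.

Lemma entry_dom c a r b s : entry c a r b s ∈ Phi -> a ∈ A /\ b ∈ B.
Proof. by move/(proj1 Phi_cont) => /nProdP [_ /nProdP [? /nProdP [_ /nProdP []]]]. Qed.

Lemma entry_inj c a r b s c' a' r' b' s' :
  entry c a r b s = entry c' a' r' b' s' -> a = a' /\ r = r'.
Proof.
by move=> /npair_inj [_ /npair_inj [-> /npair_inj [/ncode_inj -> _]]].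
Qed.

Lemma ball_uniq n w w' : ball n w -> ball n w' -> w = w'.
Proof.
move=> [c [a [m1 [n1 [d1 [b [m2 [n2 [d2 [p [e [_ [_ [_ ->]]]]]]]]]]]]]].
move=> [c' [a' [m1' [n1' [d1' [b' [m2' [n2' [d2' [p' [e' [_ [_ [_ ->]]]]]]]]]]]]]].
move: e; rewrite e' => /npair_inj [/entry_inj [-> [-> -> ->]] ->].
by [].
Qed.

Lemma ball_valid n w : ball n w -> valid n.
Proof.
move=> [c [a [m1 [n1 [d1 [b [m2 [n2 [d2 [p [e [h1 [h2 [h3 _]]]]]]]]]]]]]].
by exists c, a, m1, n1, d1, b, m2, n2, d2, p.
Qed.

Lemma valid_ball n : valid n -> exists w, ball n w.
Proof.
move=> [c [a [m1 [n1 [d1 [b [m2 [n2 [d2 [p [e [h1 [h2 h3]]]]]]]]]]]]].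
by eexists; exists c, a, m1, n1, d1, b, m2, n2, d2, p.
Qed.

Lemma ball_decode n a r : ball n ⟨a, ncode r⟩ -> exists r' b s p,
  nrel Phi a r' b s /\ val s < val q0 /\ val r = val r' - (i p + 1)^-1 /\
  i p <= i n /\ a ∈ A /\ b ∈ B /\ nrat_pos r.
Proof.
move=> [c [a' [m1 [n1 [d1 [b [m2 [n2 [d2 [p [e [h1 [/val_lt h2 [h3 /npair_inj [-> /ncode_inj ->]]]]]]]]]]]]]]].
exists (NRat m1 n1 d1), b, (NRat m2 n2 d2), p.
split; first by exists c.
split=> //; split; first exact: val_shrink.
split; first by rewrite e; case: (npair_ge (entry c a' (NRat m1 n1 d1) b (NRat m2 n2 d2)) p).
have [aA bB] := entry_dom h1; by [].
Qed.

Lemma ball_covers X : nis_point A D X -> exists n a m1 n1 p1,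
  ball n ⟨a, ncode (NRat m1 n1 p1)⟩ /\
  nreal_lt (npdist D (npt_of_elt a) (npt_of_set X)) (nreal_of_rat (NRat m1 n1 p1)).
Proof.
move=> hX; have [x px] := point_set AD hX.
case: Phi_cont => _ [_ [_ [_ /(_ X hX)]]].
have q0E : q0 = NRat (qp q0) (qn q0) (qd q0) by case: (q0).
move=> /(_ (qp q0) (qn q0) (qd q0)); rewrite -q0E => /(_ q0_pos).
move=> [a [b [m1 [n1 [d1 [m2 [n2 [d2 [[c h] [lt s]]]]]]]]]].
have aA : a ∈ A.
  by have [] := entry_dom h.
have pa := point_elt AD aA.
have [t [tr xa]] := proj1 (real_lt_near AD px pa (nrepr_rat _)) lt.
have nax := near_sym AD px pa xa.
(* The gap between the radius and the bound t on the distance absorbs the shrinking. *)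
have [|k hk] := @inv_small (val (NRat m1 n1 d1) - t); first by rewrite subr_gt0.
have tk : t < val (shrink (NRat m1 n1 d1) k) by rewrite val_shrink; lra.
exists ⟨entry c a (NRat m1 n1 d1) b (NRat m2 n2 d2), k⟩, a.
have lt' : nreal_lt (npdist D (npt_of_elt a) (npt_of_set X))
    (nreal_of_rat (shrink (NRat m1 n1 d1) k)).
  by apply/(real_lt_near AD pa px (nrepr_rat _)); exists t.
eexists; eexists; eexists; split; last exact: lt'.
exists c, a, m1, n1, d1, b, m2, n2, d2, k; do 4 (split=> //).
by apply/val_pos; have := near_ge0 AD pa px nax; lra.
Qed.

Variables (n0 w0 : nn).
Hypothesis n0w0 : ball n0 w0.

(** The code of U_n must be total in m, so its single ball is repeated for every m. Validity is
    Delta-0, which makes the case distinction definable. *)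
Lemma cover_ex : exists U, (forall z, z ∈ U -> exists n m w, z = ⟨⟨n, m⟩, w⟩) /\
  forall n m w, ⟨⟨n, m⟩, w⟩ ∈ U <-> ball n w \/ ~ valid n /\ w = w0.
Proof.
pose spec z := exists n, n ≺ z + 1 /\ exists m, m ≺ z + 1 /\
  exists w, w ≺ z + 1 /\ (z = ⟨⟨n, m⟩, w⟩ /\ (ball n w \/ ~ valid n /\ w = w0)).
have D_spec : isD0 (fun e => spec (hd e)).
  rewrite /spec; do 3 (apply: isD0_exists; [T_tac|cbv beta]).
  apply: isD0_and; first by D_tac.
  apply: isD0_or; first by apply: isD0_ball_index; T_tac.
  by apply: isD0_and; [apply/isD0_not/isD0_valid; T_tac|D_tac].
have [|| U hU] := @D1_comprehension spec; [exact: isS1_D0|exact/isS1_D0/isD0_not|].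
exists U; split.
  by move=> z /hU [n [_ [m [_ [w [_ [e _]]]]]]]; exists n, m, w.
move=> n m w; rewrite hU; split.
  by move=> [n' [_ [m' [_ [w' [_ [/npair_inj [/npair_inj [<- _] <-]]]]]]]].
move=> h; exists n; split; first by apply/i_leS; le_pair.
exists m; split; first by apply/i_leS; le_pair.
by exists w; split; first by apply/i_leS; le_pair.
Qed.

Lemma ball_range n w : ball n w -> nProd (nEl A) nQQpos w.
Proof.
move=> [c [a [m1 [n1 [d1 [b [m2 [n2 [d2 [p [e [/entry_dom [aA _] [_ [pos ->]]]]]]]]]]]]]].
by apply/nProdP; split=> //; do 3 eexists; split; last exact: pos.
Qed.

Lemma cover_open_seq U : (forall z, z ∈ U -> exists n m w, z = ⟨⟨n, m⟩, w⟩) ->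
  (forall n m w, ⟨⟨n, m⟩, w⟩ ∈ U <-> ball n w \/ ~ valid n /\ w = w0) ->
  nis_open_seq A U.
Proof.
move=> Ur UE; split; last split.
- move=> z zU; have [n [m [w e]]] := Ur z zU; rewrite e in zU *.
  apply/nProdP; split; first exact/nProdP.
  by move/UE: zU => [/ball_range //|[_ ->]]; apply: ball_range n0w0.
- move=> x [n [m [-> _]]]; case: (EM (valid n)) => [/valid_ball [w bw]|nv].
    by exists w; apply/UE; left.
  by exists w0; apply/UE; right.
- move=> x y y' [xy xy']; have [n [m [w /npair_inj [e _]]]] := Ur _ xy; subst x.
  move: xy xy' => /UE [by1|[nv ->]] /UE [by2|[nv' ->]] //.
  + exact: ball_uniq by1 by2.
  + by case: nv'; apply: ball_valid by1.
  + by case: nv; apply: ball_valid by2.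
Qed.

End Cover.

Lemma const_set c : exists X, forall z, z ∈ X <-> exists n, z = ⟨n, c⟩.
Proof.
have D_spec : isD0 (fun e => exists n, n ≺ hd e + 1 /\ hd e = ⟨n, c⟩).
  by D_tac.
have [|| X hX] := @D1_comprehension (fun z => exists n, n ≺ z + 1 /\ z = ⟨n, c⟩).
- exact: isS1_D0.
- exact/isS1_D0/isD0_not.
exists X => z; rewrite hX; split=> [[n [_ ->]]|[n ->]]; exists n => //.
by split=> //; apply: lt_npair1.
Qed.

Lemma const_set_fun (C : ncls) c X : (forall z, z ∈ X <-> exists n, z = ⟨n, c⟩) ->
  C c -> nis_fun X nNum C.
Proof.
move=> XE Cc; split; first by move=> z /XE [n ->]; apply/nProdP.
split=> [n _|n y y']; first by exists c; apply/XE; exists n.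
by move=> [/XE [n1 /npair_inj [_ ->]] /XE [n2 /npair_inj [_ ->]]].
Qed.

Lemma const_point A D d a : mspace A D d -> a ∈ A -> exists X, nis_point A D X.
Proof.
move=> AD aA; have [X XE] := const_set a; exists X; split.
  exact: const_set_fun XE aA.
move=> n b b' [/XE [n1 /npair_inj [_ ->]] /XE [n2 /npair_inj [_ ->]]].
apply/(@nat_powE _ _ True) => // e eE; split=> // _.
apply/(nrepr_real_lt (proj1 AD _ _ aA aA) (nrepr_rat e)).
(* The k-th approximation of d(a, a) may reach 2 * 2^-k, and the strict comparison costs as much
   again. *)
have [|k /(_ 0)] := @E_small (E n / 4); first by have := E_gt0 n; lra.
rewrite addr0 eE => l; exists k.
by have := proj1 (proj2 (proj2 AD)) a k aA; lra.
Qed.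

Lemma nis_real_repr X : nis_real X -> exists w, nrepr (nreal_of_set X) w /\
  forall k j, w k <= w (k + j) + E k.
Proof.
move=> [[Xr [Xt Xu]] Xc].
have [|k q q' h h'|w hw] := @nrepr_ex (nreal_of_set X).
- move=> k; have [y hy] := Xt k erefl.
  have /nProdP [_ [m [n [p e]]]] := Xr _ hy.
  by exists (NRat m n p); rewrite /nreal_of_set -e.
- by apply/ncode_inj/(Xu k).
- by exists w; split=> // k j; have [] := nrepr_cauchy hw Xc k j.
Qed.

Lemma const_real r : val r > 0 -> exists X, nis_pos_real X /\
  nrepr (nreal_of_set X) (fun=> val r).
Proof.
move=> r0; have [X XE] := const_set (ncode r); exists X.
have Xr : nrepr (nreal_of_set X) (fun=> val r).
  split=> [k|k q /XE [n /npair_inj [_ /ncode_inj ->]] //].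
  by exists r; apply/XE; exists k.
split=> //; split; last first.
  apply/(nrepr_real_lt (nrepr_rat _) Xr); rewrite val_rat0.
  have [|k /(_ 0)] := @E_small (val r / 2); first by lra.
  by rewrite addr0 => l; exists k; lra.
split; first by apply: const_set_fun XE _; case: (r) => m n p; exists m, n, p.
move=> k j m n p m' n' p' [h h']; apply/(@nat_powE _ _ True) => // e eE.
rewrite !val_le !val_add (proj2 Xr _ _ h) (proj2 Xr _ _ h') eE.
by have := E_gt0 k; split=> // _; split; lra.
Qed.

Theorem heine_borel_atsuji A D : nis_space A D -> nheine_borel A D -> natsuji A D.
Proof.
move=> /nis_space_mspace [d AD] HB B G Phi [/nis_space_mspace [g BG] cont].
move=> eps [eps_real eps_pos].
have [we [eps_repr eps_cauchy]] := nis_real_repr eps_real.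
have /(nrepr_real_lt (nrepr_rat _) eps_repr) [k] := eps_pos.
rewrite val_rat0 add0r => eps_k.
(* Positivity gives an approximation above 2 * 2^-k, of which later ones lose at most 2^-k. *)
have eps_ge j : E k <= we (k + j) by have := eps_cauchy k j; lra.
(* Without elements there are no points, and any positive delta serves; otherwise a constant point
   yields the default ball. *)
case: (EM (exists a, a ∈ A)) => [[a0 a0A]|empty]; last first.
  exists eps; split=> // X Y [[[Xr [Xt _]] _] _]; exfalso; apply: empty.
  by have [a /Xr/nProdP [_ aA]] := Xt 0 erefl; exists a.
have [p pE] : exists p, pw (k + 1 + 1) = p + 1.
  by apply: nn_pred => p0; have := pw_pos (k + 1 + 1); rewrite p0 i0 ltxx.
pose q0 := NRat 1 0 p.
have q0E : val q0 = E k / 4.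
  by rewrite val_inv -{1}i1 -iD -pE -/(E _) !ES; field.
have q0_pos : nrat_pos q0 by apply/val_pos; rewrite q0E; have := E_gt0 k; lra.
have [X0' X0_point] := const_point AD a0A.
have [n0 [a1 [m1 [n1 [p1 [n0w0 _]]]]]] := ball_covers AD cont q0_pos X0_point.
have [U [Ur UE]] := cover_ex Phi q0 ⟨a1, ncode (NRat m1 n1 p1)⟩.
have U_cover : nis_open_covering A D U.
  split=> [|X hX]; first exact: (cover_open_seq cont n0w0 Ur UE).
  have [n [a [m [n' [p' [b lt]]]]]] := ball_covers AD cont q0_pos hX.
  by exists n, 0, a, m, n', p'; split=> //; apply/UE; left.
have [Nb sub] := HB U U_cover.
(* The summand n0 accounts for points covered by the default ball, whose own index n0 may exceed
   [Nb]. *)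
pose del := NRat 1 0 (Nb + n0).
have delE : val del = (i (Nb + n0) + 1)^-1 by rewrite val_inv.
have [|del_set [del_pos del_repr]] := @const_real del.
  by rewrite delE invr_gt0 i_den.
exists del_set; split=> // X Y [hX hY] XY V W [[hV fV] [hW fW]].
have [x px] := point_set AD hX; have [y py] := point_set AD hY.
have [v pv] := point_set BG hV; have [w pw'] := point_set BG hW.
have [n [nN [m [a [m' [n' [p' [aU xa]]]]]]]] := sub X hX.
have [n2 [n2N n2b]] : exists n2, i n2 <= i (Nb + n0) /\
    ball Phi q0 n2 ⟨a, ncode (NRat m' n' p')⟩.
  move/UE: aU => [b|[_ e]].
    exists n; split=> //; move/i_lt: nN; rewrite iD; have := i_ge0 n0; lra.
  by exists n0; split; [rewrite iD; have := i_ge0 Nb; lra|rewrite e].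
have [r [b [s [p2 [rel [sq [rE [p2n [aA [bB _]]]]]]]]]] := ball_decode cont n2b.
have pa := point_elt AD aA; have pb := point_elt BG bB.
have [t2 [t2r nax]] := proj1 (real_lt_near AD pa px (nrepr_rat _)) xa.
have [t1 [t1d xy]] := proj1 (real_lt_near AD px py del_repr) XY.
have nay := near_trans AD pa px py nax xy.
have del_le : val del <= (i p2 + 1)^-1.
  by rewrite delE lef_pV2 ?posrE ?i_den //; lra.
(* With t1 < delta <= 1/(p2+1) this gives t2 < r, so that x too lies in the unshrunk ball. *)
have t1_ge0 := near_ge0 AD px py xy.
have xr : nreal_lt (npdist D (npt_of_set X) (npt_of_elt a)) (nreal_of_rat r).
  by apply/(real_lt_near AD px pa (nrepr_rat _)); exists t2; split; [lra|exact: (near_sym AD pa px nax)].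
have yr : nreal_lt (npdist D (npt_of_set Y) (npt_of_elt a)) (nreal_of_rat r).
  by apply/(real_lt_near AD py pa (nrepr_rat _)); exists (t2 + t1); split; [lra|exact: (near_sym AD pa py nay)].
have vs : nreal_lt (npdist G (npt_of_set V) (npt_of_elt b)) (nreal_of_rat s).
  by case: (r) (s) rel xr => m3 n3 p3 [m4 n4 p4] rel xr; apply: fV (conj rel xr).
have ws : nreal_lt (npdist G (npt_of_set W) (npt_of_elt b)) (nreal_of_rat s).
  by case: (r) (s) rel yr => m3 n3 p3 [m4 n4 p4] rel yr; apply: fW (conj rel yr).
have [s1 [s1s vb]] := proj1 (real_lt_near BG pv pb (nrepr_rat _)) vs.
have [s2 [s2s wb]] := proj1 (real_lt_near BG pw' pb (nrepr_rat _)) ws.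
have vw := near_trans BG pv pb pw' vb (near_sym BG pw' pb wb).
apply: (near_real_lt BG pv pw' eps_repr eps_ge _ vw).
(* Here s1 + s2 < 2 q0 = 2^-k / 2. *)
by rewrite q0E in sq; have := E_gt0 k; lra.
Qed.

End Powers.

End Field.

(* [sat] with the classical encodings of the connectives decoded, so that the
   statement is interpreted by [nstatement] up to conversion. *)
Fixpoint nsat (r : nat -> nn) (v : nat -> numset M) (p : Defs.form) : Prop :=
  match p with
  | Imp p q =>
      let arrow := nsat r v p -> nsat r v q in
      match p, q with
      | Imp p (Imp q Bot), Bot => nsat r v p /\ nsat r v q
      | AllNum (Imp p Bot), Bot => exists x, nsat (scons x r) v p
      | AllSet (Imp p Bot), Bot => exists X, nsat r (scons X v) p
      | _, _ => arrow
      end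
  | AllNum p => forall x, nsat (scons x r) v p
  | AllSet p => forall X, nsat r (scons X v) p
  | _ => sat (M := M) r v p
  end.

(** [nsat] looks several constructors deep, so its equivalence with [sat] goes by induction on size,
    not on structure. *)
Fixpoint fsize (p : Defs.form) : nat :=
  match p with
  | Imp p q => (fsize p + fsize q).+1
  | AllNum p | AllSet p => (fsize p).+1
  | _ => 0
  end.

Lemma nsat_Imp r v p q : nsat r v (Imp p q) =
  match p, q with
  | Imp p (Imp q Bot), Bot => nsat r v p /\ nsat r v q
  | AllNum (Imp p Bot), Bot => exists x, nsat (scons x r) v p
  | AllSet (Imp p Bot), Bot => exists X, nsat r (scons X v) p
  | _, _ => nsat r v p -> nsat r v q
  end.
Proof. by []. Qed.

Lemma nsatE r v p : nsat r v p <-> sat (M := M) r v p.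
Proof.
have [n] := ubnP (fsize p); elim: n r v p => // n IH r v p le.
case: p le => [s t|s t|t X||p q|p|p] le; try by []; last 2 first.
- by split=> h x; apply/(IH (scons x r) v p le); apply: h.
- by split=> h X; apply/(IH r (scons X v) p le); apply: h.
have IHs q' : (fsize q' < (fsize p + fsize q).+1)%N ->
    forall r v, nsat r v q' <-> sat (M := M) r v q'.
  by move=> l r' v'; apply: IH; apply: leq_trans l _.
have arrow : (nsat r v p -> nsat r v q) <-> sat (M := M) r v (Imp p q).
  have hp := IHs p (leq_addr _ _) r v; have hq := IHs q (leq_addl _ _) r v.
  by split=> h /hp /h /hq.
have satE : sat (M := M) r v (Imp p q) = (sat r v p -> sat r v q) by [].
rewrite nsat_Imp; rewrite satE in arrow *; move: satE => _.
case: p IHs arrow {le} => [s t|s t|t X||p1 p2|p1|p1] IHs arrow; [exact arrow..| | |].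
- case: p2 IHs arrow => [s t|s t|t X||p2 p3|p2|p2] IHs arrow;
    [exact arrow..| |exact arrow|exact arrow].
  case: p3 IHs arrow => [s t|s t|t X||? ?|?|?] IHs arrow;
    [exact arrow|exact arrow|exact arrow| |exact arrow..].
  case: q IHs arrow => [s t|s t|t X||? ?|?|?] IHs arrow;
    [exact arrow|exact arrow|exact arrow| |exact arrow..].
  apply: iff_trans (iff_sym (sat_And r v p1 p2)).
  have l1 : (fsize p1 < (fsize (Imp p1 (Imp p2 Bot)) + fsize Bot).+1)%N.
    by rewrite /= addn0 !ltnS leqW // leq_addr.
  have l2 : (fsize p2 < (fsize (Imp p1 (Imp p2 Bot)) + fsize Bot).+1)%N.
    by rewrite /= !addn0 ltnS leqW // addnS leqW // leq_addl.
  by rewrite -(IHs p1 l1) -(IHs p2 l2).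
- case: p1 IHs arrow => [s t|s t|t X||p1 p2|?|?] IHs arrow;
    [exact arrow..| |exact arrow|exact arrow].
  case: p2 IHs arrow => [s t|s t|t X||? ?|?|?] IHs arrow;
    [exact arrow|exact arrow|exact arrow| |exact arrow..].
  case: q IHs arrow => [s t|s t|t X||? ?|?|?] IHs arrow;
    [exact arrow|exact arrow|exact arrow| |exact arrow..].
  apply: iff_trans (iff_sym (sat_ExNum r v p1)).
  have l : (fsize p1 < (fsize (AllNum (Imp p1 Bot)) + fsize Bot).+1)%N.
    by rewrite /= !addn0 !ltnS leqW.
  by split=> -[x h]; exists x; apply/(IHs p1 l).
- case: p1 IHs arrow => [s t|s t|t X||p1 p2|?|?] IHs arrow;
    [exact arrow..| |exact arrow|exact arrow].
  case: p2 IHs arrow => [s t|s t|t X||? ?|?|?] IHs arrow;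
    [exact arrow|exact arrow|exact arrow| |exact arrow..].
  case: q IHs arrow => [s t|s t|t X||? ?|?|?] IHs arrow;
    [exact arrow|exact arrow|exact arrow| |exact arrow..].
  apply: iff_trans (iff_sym (sat_ExSet r v p1)).
  have l : (fsize p1 < (fsize (AllSet (Imp p1 Bot)) + fsize Bot).+1)%N.
    by rewrite /= !addn0 !ltnS leqW.
  by split=> -[x h]; exists x; apply/(IHs p1 l).
Qed.

Definition nstatement : Prop :=
  forall A D, nis_space A D /\ nheine_borel A D -> natsuji A D.

Lemma nstatement_holds : nstatement.
Proof.
move=> A D [AD HB].
have [K [i [i0 i1 iD iM [i_inj i_ge0 i_frac]]]] :=
  fraction_field nn_addI nn_mulI nn_total nn_conic nn_pred.
have [F [F_fun [F0 FS]]] := pow_set i0 i1 iD iM i_inj i_ge0.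
exact: (heine_borel_atsuji i0 i1 iD iM i_inj i_ge0 i_frac F_fun F0 FS AD HB).
Qed.

End Model.

Theorem heine_borel_atsuji_provable :
  provable RCA0 (sentence (allS (fun A => allS (fun D =>
    fimp (fand (is_space A D) (heine_borel A D)) (atsuji A D))))).
Proof.
apply: completeness => M M_RCA0 r v; apply/nsatE.
(* The value [v 0] supplies the default set of the model. *)
exact (@nstatement_holds M M_RCA0 (v 0%N)).
Qed.

End Semantics.

Import Defs.

Theorem lemma4p2 :
  provable RCA0
    (sentence (∀S A D, is_space A D /\ heine_borel A D ==> atsuji A D)%fm).
Proof. exact Semantics.heine_borel_atsuji_provable. Qed.
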